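(* Let $G$ be a finite quantum group with Haar state $\pi=\int_G$, let $\nu\in M_p(G)$ be a state on $F(G)$, and let $k\in\mathbb{N}$, $k\ge 1$. Then $$\|\nu^{\star k}-\pi\|^2\leq \frac14\sum_{\alpha\in\operatorname{Irr}(G)\setminus\{\tau\}}d_\alpha\operatorname{Tr}\left[\left(\widehat{\nu}(\alpha)^*\right)^k\left(\widehat{\nu}(\alpha)\right)^k\right],$$ where the sum is over all (equivalence classes of) non-trivial irreducible unitary representations of $G$.
   Context: A finite quantum group $G$ is given by its algebra of functions $F(G)$: a finite-dimensional unital $\mathrm{C}^*$-algebra with unit $\mathds{1}_G$, with a $*$-homomorphism $\Delta:F(G)\to F(G)\otimes F(G)$ (comultiplication), a counit $\varepsilon:F(G)\to\mathbb{C}$ and an antipode $S:F(G)\to F(G)$ satisfying the Hopf algebra axioms (coassociativity, counital property, antipodal property). The Haar state $\int_G$ is the unique state on $F(G)$ with $(I\otimes\int_G)\Delta(f)=\mathds{1}_G\int_G f=(\int_G\otimes I)\Delta(f)$ for all $f\in F(G)$; it is faithful and tracial. $M_p(G)$ is the set of states on $F(G)$. For linear functionals, $\varphi_1\star\varphi_2=(\varphi_1\otimes\varphi_2)\Delta$, and $\nu^{\star 1}=\nu$, $\nu^{\star(k+1)}=(\nu\otimes\nu^{\star k})\Delta$. The total variation distance between states is $\|\nu-\mu\|=\sup_{p}|\nu(p)-\mu(p)|$, the supremum over projections $p\in F(G)$ ($p=p^*=p^2$). A (co)representation of $G$ on a finite-dimensional complex vector space $V$ is a linear map $\kappa:V\to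 V\otimes F(G)$ with $(\kappa\otimes I)\kappa=(I_V\otimes\Delta)\kappa$ and $(I_V\otimes\varepsilon)\kappa=I_V$. Given a basis $(e_i)$ of $V$, its matrix elements $\rho_{ij}\in F(G)$ are defined by $\kappa(e_j)=\sum_i e_i\otimes\rho_{ij}$. If $V$ has an inner product, $\kappa$ is unitary if $\langle\kappa(v),\kappa(w)\rangle_{F(G)}=\langle v,w\rangle_V\mathds{1}_G$ for all $v,w$, where $\langle v\otimes a,w\otimes b\rangle_{F(G)}=\langle v,w\rangle_V\,a^*b$. The conjugate representation $\overline{\kappa}:\overline V\to\overline V\otimes F(G)$ on the conjugate space $\overline V$ is $\overline{e_j}\mapsto\sum_i\overline{e_i}\otimes\rho_{ij}^*$. $\operatorname{Irr}(G)$ indexes a complete family of pairwise inequivalent irreducible unitary representations $\kappa_\alpha$ on Hilbert spaces $V_\alpha$ of dimension $d_\alpha$; $\tau$ is the trivial representation $\lambda\mapsto\lambda\otimes\mathds{1}_G$ on $\mathbb{C}$. For a linear functional $\varphi$ on $F(G)$, its Fourier transform at $\alpha$ is $\widehat{\varphi}(\alpha)=(I_{\overline{V_\alpha}}\otimes\varphi)\circ\overline{\kappa_\alpha}\in L(\overline{V_\alpha})$. The adjoint $*$ on $L(\overline{V_\alpha})$ is with respect to the inner product on $\overline{V_\alpha}$ induced from $V_\alpha$. *)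

(* Defs.v *)
From HB Require Import structures.
From mathcomp Require Import all_boot all_order all_algebra all_field.
From mathcomp Require Import complex.
From mathcomp Require Import boolp classical_sets reals.

Set Implicit Arguments.
Unset Strict Implicit.
Unset Printing Implicit Defensive.

Import Order.TTheory GRing.Theory Num.Theory Num.Def.

Local Open Scope ring_scope.

(* [tens U V] is modelled by coordinate matrices with respect to the bases
   [vbasis fullv] of [U] and [V].  The map [ptens] is the canonical bilinear map
   [U * V -> tens U V], and [tlift b] is the linear map induced by a bilinear [b];
   see [tlift_ptens] and [tens_gen] for the universal property. *)
Notation tens U V := 'M_(\dim {:U}, \dim {:V}).

Section Tensor.
Variable K : fieldType.
Implicit Types U V W : vectType K.

Definition fbasis V : (\dim {:V}).-tuple V := vbasis fullv.

Definition ptens U V (u : U) (v : V) : tens U V :=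
  \matrix_(i, j) (coord (fbasis U) i u * coord (fbasis V) j v).

Definition tlift U V W (b : U -> V -> W) (t : tens U V) : W :=
  \sum_i \sum_j t i j *: b (fbasis U)`_i (fbasis V)`_j.

Lemma tlift_linear U V W (b : U -> V -> W) : linear (tlift b).
Proof.
move=> a s t; rewrite /tlift scaler_sumr -big_split; apply: eq_bigr => i _ /=.
rewrite scaler_sumr -big_split; apply: eq_bigr => j _ /=.
by rewrite !mxE scalerDl scalerA.
Qed.

HB.instance Definition _ U V W (b : U -> V -> W) :=
  GRing.isLinear.Build K (tens U V) W _ (tlift b) (tlift_linear b).

Lemma ptens_bilinear U V :
  bilinear_for *:%R *:%R (@ptens U V).
Proof.
split=> [v a u u'|u a v v']; apply/matrixP=> i j; rewrite !mxE linearP /=.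
  by rewrite mulrDl mulrA.
by rewrite mulrDr mulrCA.
Qed.

Lemma fbasisE V (v : V) : \sum_i coord (fbasis V) i v *: (fbasis V)`_i = v.
Proof. by rewrite -coord_vbasis ?memvf. Qed.

Lemma coord_fbasis V (i j : 'I_(\dim {:V})) :
  coord (fbasis V) i (fbasis V)`_j = (i == j)%:R.
Proof. by rewrite coord_free ?(basis_free (vbasisP _)) // eq_sym. Qed.

Lemma tlift_ptens U V W (b : U -> V -> W) :
  bilinear_for *:%R *:%R b -> forall u v, tlift b (ptens u v) = b u v.
Proof.
case=> bl br u v; rewrite /tlift -[in RHS](fbasisE u) -[in RHS](fbasisE v).
pose bL w := HB.pack_for {linear U -> W} (b^~ w) (GRing.isLinear.Build _ _ _ _ _ (bl w)).
pose bR w := HB.pack_for {linear V -> W} (b w) (GRing.isLinear.Build _ _ _ _ _ (br w)).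
rewrite -[RHS]/(bL _ _) linear_sum; apply: eq_bigr => i _; rewrite linearZ /=.
rewrite -[b _ _]/(bR _ _) linear_sum scaler_sumr; apply: eq_bigr => j _.
by rewrite linearZ scalerA mxE.
Qed.

Lemma tens_gen U V (t : tens U V) : t = tlift (@ptens U V) t.
Proof.
apply/matrixP=> i j; rewrite /tlift summxE (bigD1 i) //= summxE (bigD1 j) //=.
rewrite !mxE !coord_fbasis !eqxx !mulr1 big1 => [|l nl]; last first.
  by rewrite !mxE !coord_fbasis [j == l]eq_sym (negPf nl) !mulr0.
rewrite addr0 big1 ?addr0 // => k nk; rewrite summxE big1 // => l _.
by rewrite !mxE !coord_fbasis [i == k]eq_sym (negPf nk) mul0r mulr0.
Qed.

(* [tmap f g] is f (x) g. *)
Definition tmap U V U' V' (f : U -> U') (g : V -> V') : tens U V -> tens U' V' :=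
  tlift (fun u v => ptens (f u) (g v)).

(* The canonical isomorphism (U (x) V) (x) W -> U (x) (V (x) W). *)
Definition tassoc U V W : tens (tens U V) W -> tens U (tens V W) :=
  tlift (fun s w => tlift (fun u v => ptens u (ptens v w)) s).

(* I (x) phi and phi (x) I, after identifying V (x) K and K (x) V with V. *)
Definition slicer U V (phi : V -> K) : tens U V -> U :=
  tlift (fun u v => phi v *: u).
Definition slicel U V (phi : U -> K) : tens U V -> V :=
  tlift (fun u v => phi u *: v).

(* phi (x) psi, after identifying K (x) K with K. *)
Definition tfun U V (phi : U -> K) (psi : V -> K) : tens U V -> K^o :=
  tlift (fun u v => phi u * psi v : K^o).

HB.instance Definition _ U V U' V' (f : U -> U') (g : V -> V') :=
  GRing.Linear.on (tmap f g).
HB.instance Definition _ U V W := GRing.Linear.on (@tassoc U V W).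
HB.instance Definition _ U V (phi : V -> K) := GRing.Linear.on (@slicer U V phi).
HB.instance Definition _ U V (phi : U -> K) := GRing.Linear.on (@slicel U V phi).
HB.instance Definition _ U V (phi : U -> K) (psi : V -> K) :=
  GRing.Linear.on (@tfun U V phi psi).

Definition tsub U V (W : {vspace U}) : {vspace tens U V} :=
  <<[seq ptens w v | w <- vbasis W, v <- fbasis V]>>%VS.

Definition lfun_trace V (f : 'End(V)) : K := \tr (passmx.mxof (fbasis V) (fbasis V) f).

Definition lfun_pow V (f : 'End(V)) (k : nat) : 'End(V) :=
  iter k (comp_lfun f) \1%VF.

End Tensor.

Section CStar.
Variable R : realType.
Local Notation C := R[i].

(* Completeness of the norm is automatic in finite dimension. *)
Record cstarAlg := CStarAlg {
  cstar_sort :> falgType C;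
  star : cstar_sort -> cstar_sort;
  cnorm : cstar_sort -> R;
  starK : involutive star;
  starD : {morph star : x y / x + y};
  starZ : forall (a : C) x, star (a *: x) = a^* *: star x;
  starM : forall x y, star (x * y) = star y * star x;
  cnorm_eq0 : forall x, cnorm x = 0 -> x = 0;
  cnormD : forall x y, cnorm (x + y) <= cnorm x + cnorm y;
  cnormZ : forall (a : C) x, cnorm (a *: x) = Normc.normc a * cnorm x;
  cnormM : forall x y, cnorm (x * y) <= cnorm x * cnorm y;
  cnorm_cstar : forall x, cnorm (star x * x) = cnorm x ^+ 2
}.

Definition tmul (A : cstarAlg) (s t : tens A A) : tens A A :=
  tlift (fun a b => tlift (fun c d => ptens (a * c) (b * d)) t) s.

Definition tstar (A : cstarAlg) (t : tens A A) : tens A A :=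
  \sum_i \sum_j (t i j)^* *: ptens (star (fbasis A)`_i) (star (fbasis A)`_j).

Record fqgroup := FQGroup {
  fq_alg :> cstarAlg;
  Delta : {linear fq_alg -> tens fq_alg fq_alg};
  counit : {linear fq_alg -> C^o};
  antipode : {linear fq_alg -> fq_alg};
  Delta1 : Delta 1 = ptens 1 1;
  DeltaM : forall f g, Delta (f * g) = tmul (Delta f) (Delta g);
  Delta_star : forall f, Delta (star f) = tstar (Delta f);
  counit1 : counit 1 = 1;
  counitM : forall f g, counit (f * g) = counit f * counit g;
  coassoc : forall f, tassoc (tmap Delta idfun (Delta f)) = tmap idfun Delta (Delta f);
  counit_l : forall f, slicel counit (Delta f) = f;
  counit_r : forall f, slicer counit (Delta f) = f;
  antipode_l : forall f, tlift (fun a b => antipode a * b) (Delta f) = counit f *: 1;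
  antipode_r : forall f, tlift (fun a b => a * antipode b) (Delta f) = counit f *: 1
}.

Arguments Delta {_}.
Arguments counit {_}.
Arguments antipode {_}.

Definition is_state (A : cstarAlg) (phi : {linear A -> C^o}) : Prop :=
  phi 1 = 1 /\ forall a, 0 <= (phi (star a * a) : C).

(* Faithfulness and traciality follow and are not part of the definition. *)
Definition is_haar (G : fqgroup) (phi : {linear G -> C^o}) : Prop :=
  is_state phi /\
  forall f, slicer phi (Delta f) = phi f *: 1 /\ slicel phi (Delta f) = phi f *: 1.

Definition conv (G : fqgroup) (phi psi : {linear G -> C^o}) : {linear G -> C^o} :=
  tfun phi psi \o Delta.

(* nu^{* k} for k >= 1; the value at k = 0 is irrelevant. *)
Definition convpow (G : fqgroup) (nu : {linear G -> C^o}) (k : nat) :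
    {linear G -> C^o} :=
  iter k.-1 (conv nu) nu.

Definition is_projection (A : cstarAlg) (p : A) : Prop := star p = p /\ p * p = p.

Definition tvdist (A : cstarAlg) (nu mu : {linear A -> C^o}) : R :=
  sup [set Normc.normc (nu p - mu p : C) | p in [set p : A | is_projection p]]%classic.

Record hilbert := Hilbert {
  hilbert_sort :> vectType C;
  hform : {dot hilbert_sort for conjC}
}.

(* [{dot _ for conjC}] is linear in its first argument and antilinear in the
   second; [hip] is antilinear in the first. *)
Definition hip (V : hilbert) (v w : V) : C := hform V w v.

Section Corep.
Variable G : fqgroup.

Definition is_corep (V : vectType C) (kappa : {linear V -> tens V G}) : Prop :=
  (forall v, tassoc (tmap kappa idfun (kappa v)) = tmap idfun Delta (kappa v))
  /\ (forall v, slicer counit (kappa v) = v).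

(* <v (x) a, w (x) b> = <v, w> a^* b, extended sesquilinearly. *)
Definition tens_ip (V : hilbert) (s t : tens V G) : G :=
  \sum_i \sum_j \sum_k \sum_l
    ((s i j)^* * t k l * hip (fbasis V)`_i (fbasis V)`_k) *:
      (star (fbasis G)`_j * (fbasis G)`_l).

Definition is_unitary (V : hilbert) (kappa : {linear V -> tens V G}) : Prop :=
  forall v w, tens_ip (kappa v) (kappa w) = hip v w *: 1.

Definition is_invariant (V : vectType C) (kappa : {linear V -> tens V G})
    (W : {vspace V}) : Prop :=
  forall w, w \in W -> kappa w \in tsub G W.

Definition irreducible (V : vectType C) (kappa : {linear V -> tens V G}) : Prop :=
  {:V}%VS <> 0%VS /\
  forall W : {vspace V}, is_invariant kappa W -> W = 0%VS \/ W = fullv.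

Definition equivalent (V W : vectType C) (kappa : {linear V -> tens V G})
    (lambda : {linear W -> tens W G}) : Prop :=
  exists T : 'Hom(V, W),
    bijective T /\ forall v, lambda (T v) = tmap T idfun (kappa v).

Definition trivrep (z : C^o) : tens (C^o : vectType C) G := ptens z 1.

Lemma trivrep_linear : linear trivrep.
Proof. exact: (ptens_bilinear _ _).1. Qed.

HB.instance Definition _ :=
  GRing.isLinear.Build C C^o (tens (C^o : vectType C) G) _ trivrep trivrep_linear.

(* rho_ij, where kappa e_j = \sum_i e_i (x) rho_ij and e = fbasis V. *)
Definition matelt (V : vectType C) (kappa : {linear V -> tens V G})
    (i j : 'I_(\dim {:V})) : G :=
  slicel (coord (fbasis V) i) (kappa (fbasis V)`_j).

End Corep.

Definition conjsp (V : vectType C) : Type := V.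

Section ConjSpace.
Variable V : vectType C.

HB.instance Definition _ := GRing.Zmodule.on (conjsp V).

Definition conj_scale (a : C) (v : conjsp V) : conjsp V := a^* *: (v : V).

Fact conj_scaleA a b v : conj_scale a (conj_scale b v) = conj_scale (a * b) v.
Proof. by rewrite /conj_scale scalerA rmorphM. Qed.
Fact conj_scale1 : left_id 1 conj_scale.
Proof. by move=> v; rewrite /conj_scale rmorph1 scale1r. Qed.
Fact conj_scaleDr : right_distributive conj_scale +%R.
Proof. by move=> a u v; rewrite /conj_scale scalerDr. Qed.
Fact conj_scaleDl v : {morph conj_scale^~ v : a b / a + b}.
Proof. by move=> a b; rewrite /conj_scale rmorphD scalerDl. Qed.

HB.instance Definition _ := GRing.Zmodule_isLmodule.Build C (conjsp V)
  conj_scaleA conj_scale1 conj_scaleDr conj_scaleDl.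

Fact conjsp_vector_axiom : Vector.axiom (\dim {:V}) (conjsp V).
Proof.
exists (fun v : conjsp V => \row_i (coord (fbasis V) i (v : V))^*).
  move=> a u v; apply/rowP=> i; rewrite !mxE.
  by rewrite -[a *: u]/(a^* *: (u : V)) linearP rmorphD rmorphM /= conjCK.
exists (fun r : 'rV_ _ => \sum_i (r 0 i)^* *: (fbasis V)`_i) => [v|r].
  by rewrite -[RHS]fbasisE; apply: eq_bigr => i _; rewrite mxE conjCK.
apply/rowP=> i; rewrite mxE linear_sum (bigD1 i) //= big1 => [|j nj].
  by rewrite linearZ /= coord_fbasis eqxx mulr1 addr0 conjCK.
by rewrite linearZ /= coord_fbasis eq_sym (negPf nj) mulr0.
Qed.

HB.instance Definition _ :=
  Lmodule_hasFinDim.Build C (conjsp V) conjsp_vector_axiom.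

End ConjSpace.

Definition conjv (V : vectType C) (v : V) : conjsp V := v.

(* <bar v, bar w> = <w, v>, the inner product induced on the conjugate space. *)
Definition conj_hip (V : hilbert) (v w : conjsp V) : C := hip (w : V) (v : V).

(* The linear extension of bar e_j |-> \sum_i bar e_i (x) rho_ij^*; the
   coordinate of bar v along bar e_j is the conjugate of that of v along e_j. *)
Definition conjrep (G : fqgroup) (V : vectType C) (kappa : {linear V -> tens V G})
    (v : conjsp V) : tens (conjsp V) G :=
  \sum_j (coord (fbasis V) j (v : V))^* *:
    \sum_(i < \dim {:V}) ptens (conjv (fbasis V)`_i) (star (matelt kappa i j)).

Lemma conjrep_linear (G : fqgroup) (V : vectType C)
    (kappa : {linear V -> tens V G}) :
  linear (conjrep kappa).
Proof.
move=> a u v; rewrite /conjrep scaler_sumr -big_split; apply: eq_bigr => j _ /=.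
rewrite -[a *: u]/(a^* *: (u : V)) linearP rmorphD rmorphM /= conjCK.
by rewrite scalerDl scalerA.
Qed.

HB.instance Definition _ (G : fqgroup) (V : vectType C)
    (kappa : {linear V -> tens V G}) :=
  GRing.isLinear.Build C (conjsp V) (tens (conjsp V) G) _ (conjrep kappa)
    (conjrep_linear kappa).

Definition fourier (G : fqgroup) (V : vectType C) (kappa : {linear V -> tens V G})
    (phi : {linear G -> C^o}) : 'End(conjsp V) :=
  linfun (@slicer _ (conjsp V) G phi \o conjrep kappa).

Definition is_adjoint (V : hilbert) (T S : 'End(conjsp V)) : Prop :=
  forall v w, conj_hip (S v) w = conj_hip v (T w).

(* The unique S with <S v, w> = <v, T w>; the default value 0 is never reached,
   since adjoints exist in finite dimension. *)
Definition adjoint (V : hilbert) (T : 'End(conjsp V)) : 'End(conjsp V) :=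
  xget 0 [set S | is_adjoint T S]%classic.

(* Finiteness of the index set is automatic: matrix elements of inequivalent
   irreducibles are linearly independent in the finite-dimensional F(G). *)
Record irrFamily (G : fqgroup) := IrrFamily {
  Irr :> finType;
  irr_sp : Irr -> hilbert;
  irr_rep : forall a : Irr, {linear irr_sp a -> tens (irr_sp a) G};
  irr_corep : forall a, is_corep (irr_rep a);
  irr_unitary : forall a, is_unitary (irr_rep a);
  irr_irreducible : forall a, irreducible (irr_rep a);
  irr_inequiv : forall a b, equivalent (irr_rep a) (irr_rep b) -> a = b;
  irr_complete : forall (V : hilbert) (kappa : {linear V -> tens V G}),
    is_corep kappa -> is_unitary kappa -> irreducible kappa ->
    exists a, equivalent kappa (irr_rep a)
}.

End CStar.

Arguments Delta {_ _}.
Arguments counit {_ _}.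
Arguments antipode {_ _}.

(* Main.v *)
Require Import Defs.
From HB Require Import structures.
From mathcomp Require Import all_boot all_order all_algebra all_field.
From mathcomp Require Import complex.
From mathcomp Require Import boolp classical_sets reals.
From mathcomp Require Import ring.

(** Write [mu = nu^{*k} - pi].  Peter-Weyl theory gives [mu = pi (_ * f)] with
    [f = \sum_a d_a \sum_ij mu (rho^a_ij^* ) rho^a_ij], where the trivial
    representation does not contribute because [mu 1 = 0].  A projection [p]
    yields the self-adjoint unitary [2p - 1], for which [mu (2p - 1) = 2 mu p],
    and Cauchy-Schwarz for [pi] bounds [4 |mu p|^2] by [pi (f^* f)], which is the
    right-hand side computed in orthonormal bases.

    Peter-Weyl theory needs that [pi] is faithful and tracial.  Faithfulness: by
    strong invariance, [N = {a | pi (x a) = 0 for all x}] satisfies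
    [Delta N <= A (x) N], and the antipode gives [counit a * 1 = S(a_1) a_2] in
    [N], so the counit vanishes on [N] and [a = a_1 counit a_2 = 0].
    Traciality: the normalised trace of the regular representation is a faithful
    tracial state which is idempotent for convolution, hence it is invariant and
    coincides with [pi].

    Completeness of the irreducible coefficients: their [pi]-orthogonal complement
    is invariant under [Delta], and a minimal nonzero invariant subspace of it
    would be an irreducible representation whose coefficients contain it. *)

Set Implicit Arguments.
Unset Strict Implicit.
Unset Printing Implicit Defensive.
Import Order.TTheory GRing.Theory Num.Theory.
Local Open Scope ring_scope.

(** * Tensors in coordinates *)

Section TensorCalculus.
Variable K : fieldType.
Implicit Types U V W : vectType K.

Lemma scalarf_sum V (phi : V -> K) (I : Type) (s : seq I) (P : pred I) (F : I -> V) :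
  scalar phi -> phi (\sum_(i <- s | P i) F i) = \sum_(i <- s | P i) phi (F i).
Proof.
move=> h; pose L := HB.pack_for {linear V -> K^o} phi (GRing.isLinear.Build _ _ _ _ _ h).
exact: (linear_sum L).
Qed.

Lemma scalarf0 V (phi : V -> K) : scalar phi -> phi 0 = 0.
Proof. by move=> h; have /= := h (-1) 0 0; rewrite scaler0 addr0 mulN1r addNr. Qed.

Lemma scalarfZ V (phi : V -> K) a v : scalar phi -> phi (a *: v) = a * phi v.
Proof. by move=> h; have := h a v 0; rewrite addr0 scalarf0 // addr0. Qed.

Lemma scalarfD V (phi : V -> K) u v : scalar phi -> phi (u + v) = phi u + phi v.
Proof. by move=> h; have := h 1 u v; rewrite scale1r mul1r. Qed.

Lemma scalarfB V (phi : V -> K) u v : scalar phi -> phi (u - v) = phi u - phi v.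
Proof. by move=> h; rewrite scalarfD // -scaleN1r scalarfZ // mulN1r. Qed.

Lemma ptensDl U V (u u' : U) (v : V) : ptens (u + u') v = ptens u v + ptens u' v.
Proof. by have := (ptens_bilinear U V).1 v 1 u u'; rewrite /= !scale1r. Qed.

Lemma ptensDr U V (u : U) (v v' : V) : ptens u (v + v') = ptens u v + ptens u v'.
Proof. by have := (ptens_bilinear U V).2 u 1 v v'; rewrite /= !scale1r. Qed.

Lemma ptens0l U V (v : V) : ptens (0 : U) v = 0.
Proof. by apply: (addrI (ptens (0 : U) v)); rewrite -ptensDl !addr0. Qed.

Lemma ptens0r U V (u : U) : ptens u (0 : V) = 0.
Proof. by apply: (addrI (ptens u (0 : V))); rewrite -ptensDr !addr0. Qed.

Lemma ptensZl U V a (u : U) (v : V) : ptens (a *: u) v = a *: ptens u v.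
Proof. by have := (ptens_bilinear U V).1 v a u 0; rewrite /= ptens0l !addr0. Qed.

Lemma ptensZr U V a (u : U) (v : V) : ptens u (a *: v) = a *: ptens u v.
Proof. by have := (ptens_bilinear U V).2 u a v 0; rewrite /= ptens0r !addr0. Qed.

Lemma ptens_suml U V (I : Type) (s : seq I) (P : pred I) (F : I -> U) (v : V) :
  ptens (\sum_(i <- s | P i) F i) v = \sum_(i <- s | P i) ptens (F i) v.
Proof. by elim/big_rec2: _ => [|i x y _ <-]; rewrite ?ptens0l ?ptensDl. Qed.

Lemma ptens_sumr U V (I : Type) (s : seq I) (P : pred I) (F : I -> V) (u : U) :
  ptens u (\sum_(i <- s | P i) F i) = \sum_(i <- s | P i) ptens u (F i).
Proof. by elim/big_rec2: _ => [|i x y _ <-]; rewrite ?ptens0r ?ptensDr. Qed.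

Lemma tens_expandl U V (t : tens U V) :
  t = \sum_(i < \dim {:U}) ptens (fbasis U)`_i (\sum_(j < \dim {:V}) t i j *: (fbasis V)`_j).
Proof.
rewrite {1}(tens_gen t) /tlift; apply: eq_bigr => i _.
by rewrite ptens_sumr; apply: eq_bigr => j _; rewrite ptensZr.
Qed.

(** Elementary tensors span by [tens_expandl], so linear identities need checking only on them. *)
Lemma tens_ind U V (P : tens U V -> Prop) :
  P 0 -> (forall s t, P s -> P t -> P (s + t)) -> (forall u v, P (ptens u v)) ->
  forall t, P t.
Proof. by move=> P0 PD Pp t; rewrite (tens_expandl t); elim/big_ind: _. Qed.

Lemma slicer_ptens U V (phi : V -> K) : scalar phi ->
  forall (u : U) v, slicer phi (ptens u v) = phi v *: u.
Proof.
move=> h u v; rewrite /slicer tlift_ptens //; split=> [w a x y|x a y z] /=.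
  by rewrite scalerDr !scalerA mulrC.
by rewrite h scalerDl scalerA.
Qed.

Lemma slicel_ptens U V (phi : U -> K) : scalar phi ->
  forall u (v : V), slicel phi (ptens u v) = phi u *: v.
Proof.
move=> h u v; rewrite /slicel tlift_ptens //; split=> [x a y z|w a x y] /=.
  by rewrite h scalerDl scalerA.
by rewrite scalerDr !scalerA mulrC.
Qed.

Lemma tfun_ptens U V (phi : U -> K) (psi : V -> K) : scalar phi -> scalar psi ->
  forall u v, tfun phi psi (ptens u v) = phi u * psi v.
Proof.
move=> h1 h2 u v; rewrite /tfun tlift_ptens //; split=> [w a x y|x a y z] /=.
  by rewrite h1 mulrDl -mulrA.
by rewrite h2 mulrDr mulrCA.
Qed.

Lemma tmap_ptens U V U' V' (f : {linear U -> U'}) (g : {linear V -> V'}) u v :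
  tmap f g (ptens u v) = ptens (f u) (g v).
Proof.
rewrite /tmap tlift_ptens //; split=> [w a x y|x a y z] /=.
  by rewrite linearP ptensDl ptensZl.
by rewrite linearP ptensDr ptensZr.
Qed.

Lemma tassoc_ptens U V W (s : tens U V) (w : W) :
  tassoc (ptens s w) = tlift (fun u v => ptens u (ptens v w)) s.
Proof.
rewrite /tassoc tlift_ptens //; split=> [x a y z|t a y z] /=; first by rewrite linearP.
(* Linearity in the last leg is checked on elementary [t], where the inner lift can be evaluated. *)
elim/tens_ind: t => [|s1 s2 h1 h2|u v]; first by rewrite !linear0 ?scaler0 ?addr0.
  by rewrite !linearD /= h1 h2 addrACA.
have B w' : bilinear_for *:%R *:%R (fun (u : U) (v : V) =>
  ptens u (ptens v w') : tens U (tens V W)).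
  split=> [x b y' z'|x b y' z'] /=; first by rewrite ptensDl ptensZl.
  by rewrite ptensDl ptensZl ptensDr ptensZr.
by rewrite !tlift_ptens // ptensDr ptensDr ptensZr ptensZr.
Qed.

Lemma tassoc_ptens3 U V W (u : U) (v : V) (w : W) :
  tassoc (ptens (ptens u v) w) = ptens u (ptens v w).
Proof.
rewrite tassoc_ptens tlift_ptens //; split=> [x b y' z'|x b y' z'] /=.
  by rewrite ptensDl ptensZl.
by rewrite ptensDl ptensZl ptensDr ptensZr.
Qed.

Lemma tmap_sum U V U' V' (f : {linear U -> U'}) (g : {linear V -> V'})
    (I : finType) (x : I -> U) (y : I -> V) :
  tmap f g (\sum_i ptens (x i) (y i)) = \sum_i ptens (f (x i)) (g (y i)).
Proof.
rewrite (@linear_sum _ _ _ _ (@tmap _ U V U' V' f g)).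
by apply: eq_bigr => i _; exact: tmap_ptens.
Qed.

Lemma slicer_sum U V (phi : V -> K) (I : finType) (x : I -> U) (y : I -> V) :
  scalar phi -> slicer phi (\sum_i ptens (x i) (y i)) = \sum_i phi (y i) *: x i.
Proof.
move=> h; rewrite (@linear_sum _ _ _ _ (@slicer _ U V phi)).
by apply: eq_bigr => i _; exact: slicer_ptens.
Qed.

Lemma slicel_sum U V (phi : U -> K) (I : finType) (x : I -> U) (y : I -> V) :
  scalar phi -> slicel phi (\sum_i ptens (x i) (y i)) = \sum_i phi (x i) *: y i.
Proof.
move=> h; rewrite (@linear_sum _ _ _ _ (@slicel _ U V phi)).
by apply: eq_bigr => i _; exact: slicel_ptens.
Qed.

Lemma tfun_sum U V (phi : U -> K) (psi : V -> K) (I : finType) (x : I -> U) (y : I -> V) :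
  scalar phi -> scalar psi ->
  tfun phi psi (\sum_i ptens (x i) (y i)) = \sum_i phi (x i) * psi (y i).
Proof.
move=> h1 h2; rewrite (@linear_sum _ _ _ _ (@tfun _ U V phi psi)).
by apply: eq_bigr => i _; exact: tfun_ptens.
Qed.

Lemma tlift_sum U V W (b : U -> V -> W) (I : finType) (x : I -> U) (y : I -> V) :
  bilinear_for *:%R *:%R b ->
  tlift b (\sum_i ptens (x i) (y i)) = \sum_i b (x i) (y i).
Proof.
by move=> hb; rewrite linear_sum; apply: eq_bigr => i _; exact: tlift_ptens.
Qed.

Lemma tassoc_sum U V W (I : finType) (t : I -> tens (tens U V) W) :
  tassoc (\sum_i t i) = \sum_i tassoc (t i).
Proof. exact: (@linear_sum _ _ _ _ (@tassoc _ U V W)). Qed.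

Lemma coord_scalar V (i : 'I_(\dim {:V})) : scalar (coord (fbasis V) i).
Proof. by move=> a u v; rewrite linearP. Qed.

Lemma linear_scalar V (phi : {linear V -> K^o}) : scalar phi.
Proof. by move=> a u v; rewrite linearP. Qed.

Lemma tens_expand_slicer U V (t : tens U V) :
  t = \sum_(j < \dim {:V}) ptens (slicer (coord (fbasis V) j) t) (fbasis V)`_j.
Proof.
elim/tens_ind: t => [|s t hs ht|u v].
- by rewrite big1 // => j _; rewrite linear0 ptens0l.
- rewrite {1}hs {1}ht -big_split; apply: eq_bigr => j _ /=.
  by rewrite linearD ptensDl.
rewrite -{1}(fbasisE v) ptens_sumr; apply: eq_bigr => j _.
by rewrite (slicer_ptens (@coord_scalar V j)) ptensZl ptensZr.
Qed.

(** Stated for any resolution of the identity, because later expansions use orthonormal bases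
    instead of [fbasis]. *)
Lemma tens_expand_slicel U V n (b : 'I_n -> U) (phi : 'I_n -> U -> K) (t : tens U V) :
  (forall i, scalar (phi i)) -> (forall u, \sum_i phi i u *: b i = u) ->
  t = \sum_i ptens (b i) (slicel (phi i) t).
Proof.
move=> hphi hb; elim/tens_ind: t => [|s t hs ht|u v].
- by rewrite big1 // => j _; rewrite linear0 ptens0r.
- rewrite {1}hs {1}ht -big_split; apply: eq_bigr => j _ /=.
  by rewrite linearD ptensDr.
rewrite -{1}(hb u) ptens_suml; apply: eq_bigr => j _.
by rewrite slicel_ptens // ptensZl ptensZr.
Qed.

(** Reduces invariance of subspaces to a condition on slices, the form used from here on. *)
Lemma mem_tsubP U V (W : {vspace U}) (t : tens U V) :
  t \in tsub V W <-> forall phi : V -> K, scalar phi -> slicer phi t \in W.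
Proof.
split=> [tW phi hphi|h].
  have /subvP/(_ t tW) : (tsub V W <= linfun (@slicer _ U V phi) @^-1: W)%VS.
    apply/span_subvP => _ /allpairsP[[w v] [/= wW _ ->]].
    by rewrite -memv_preim lfunE /= slicer_ptens // memvZ // vbasis_mem.
  by rewrite -memv_preim lfunE.
rewrite (tens_expand_slicer t) memv_suml // => j _.
rewrite (coord_vbasis (h _ (@coord_scalar V j))) ptens_suml memv_suml // => i _.
rewrite ptensZl memvZ // memv_span //; apply/allpairsP.
by exists ((vbasis W)`_i, (fbasis V)`_j); split; rewrite //= mem_nth // size_tuple.
Qed.

Lemma slicer_inj U V (s t : tens U V) :
  (forall phi : V -> K, scalar phi -> slicer phi s = slicer phi t) -> s = t.
Proof.
move=> h; rewrite (tens_expand_slicer s) (tens_expand_slicer t); apply: eq_bigr => j _.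
by rewrite h //; apply: coord_scalar.
Qed.

(** Inserting the resolution of the identity and exchanging the sums moves the trace from [fbasis]
    to [e], so that orthonormal bases become available. *)
Lemma lfun_traceE V (f : 'End(V)) n (e : 'I_n -> V) (phi : 'I_n -> V -> K) :
  (forall i, scalar (phi i)) -> (forall v, \sum_i phi i v *: e i = v) ->
  lfun_trace f = \sum_i phi i (f (e i)).
Proof.
move=> hphi he; rewrite /lfun_trace /mxtrace.
transitivity (\sum_(i < \dim {:V}) coord (fbasis V) i (f (fbasis V)`_i)).
  apply: eq_bigr => i _; rewrite /passmx.mxof !mxE.
  by rewrite passmx.vecof_delta.
under eq_bigr => i _ do rewrite -{1}(he (fbasis V)`_i) linear_sum linear_sum /=.
rewrite exchange_big; apply: eq_bigr => k _ /=.
under eq_bigr => i _ do rewrite linearZ linearZ /= mulrC.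
rewrite -[in RHS](fbasisE (f (e k))) scalarf_sum //.
by apply: eq_bigr => i _; rewrite scalarfZ.
Qed.

End TensorCalculus.

(** * Hermitian forms *)

Section HermitianForms.
Variables (C : numClosedFieldType) (V : vectType C) (h : V -> V -> C).
Hypothesis h_scalar : forall v, scalar (h v).
Hypothesis h_conj : forall v w, h w v = (h v w)^*.

Lemma hermDl u v w : h (u + v) w = h u w + h v w.
Proof. by rewrite h_conj scalarfD // rmorphD /= -!h_conj. Qed.

Lemma hermZl a u w : h (a *: u) w = a^* * h u w.
Proof. by rewrite h_conj scalarfZ // rmorphM /= -!h_conj. Qed.

Lemma herm_suml (I : Type) (s : seq I) (P : pred I) (F : I -> V) w :
  h (\sum_(i <- s | P i) F i) w = \sum_(i <- s | P i) h (F i) w.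
Proof.
by rewrite h_conj scalarf_sum // rmorph_sum /=; apply: eq_bigr => i _; rewrite -h_conj.
Qed.

(** The form is only semidefinite: faithfulness of the Haar state will be deduced from this
    inequality. Null vectors are therefore treated apart. *)
Lemma herm_CauchySchwarz (h_ge0 : forall v, 0 <= h v v) x y :
  `|h x y| ^+ 2 <= h x x * h y y.
Proof.
(* Positivity at [h v v] times the component of [u] orthogonal to [v], which avoids a division. *)
have key (u v : V) : 0 <= h v v * (h u u * h v v - `|h u v| ^+ 2).
  have := h_ge0 (h v v *: u - h v u *: v).
  rewrite scalarfB // !scalarfZ // -!scaleNr !hermDl !hermZl !rmorphN /= -!h_conj.
  rewrite normCK -(h_conj u v).
  have -> // : h v v * (h v v * h u u + - h u v * h v u) -
     h v u * (h v v * h u v + - h u v * h v v) = h v v * (h u u * h v v - h u v * h v u).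
  by ring.
have [y0|y0] := eqVneq (h y y) 0; last first.
  by rewrite -subr_ge0 -(pmulr_rge0 _ (_ : 0 < h y y)) ?key // lt0r y0 h_ge0.
have [x0|x0] := eqVneq (h x x) 0; last first.
  have := key y x; rewrite pmulr_rge0 ?lt0r ?x0 ?h_ge0 //.
  by rewrite subr_ge0 h_conj norm_conjC mulrC.
rewrite x0 mul0r.
(* Both squared norms are zero here, so positivity at this vector reads -2 |h x y|^2 >= 0. *)
have := h_ge0 (x - h y x *: y).
rewrite scalarfB // !scalarfZ // -!scaleNr !hermDl !hermZl !rmorphN /= -!h_conj x0 y0.
rewrite normCK -(h_conj x y) => le; rewrite -(pmulr_rle0 _ (ltr0Sn C 1)).
rewrite -oppr_ge0; apply: le_trans le _; rewrite le_eqVlt; apply/orP; left.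
by apply/eqP; ring.
Qed.

End HermitianForms.

(** Polarisation: reality of the form at [v + w] and at [v + 'i *: w] gives two linear relations
    between [h v w], [h w v] and their conjugates. *)
Lemma herm_of_ge0 (C : numClosedFieldType) (V : vectType C) (h : V -> V -> C) :
  (forall v, scalar (h v)) ->
  (forall u v w, h (u + v) w = h u w + h v w) ->
  (forall a u w, h (a *: u) w = a^* * h u w) ->
  (forall v, 0 <= h v v) -> forall v w, h w v = (h v w)^*.
Proof.
move=> hs hD hZ h0 v w.
have real (u : V) : (h u u)^* = h u u by apply/CrealP; rewrite realE h0.
have : (h (v + w) (v + w))^* = h (v + w) (v + w) by apply: real.
rewrite !hD !scalarfD // !rmorphD /= !real => e1.
have e2 : (h (v + 'i *: w) (v + 'i *: w))^* = h (v + 'i *: w) (v + 'i *: w) by apply: real.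
have E : h (v + 'i *: w) (v + 'i *: w) = h v v + 'i * (h v w - h w v) + h w w.
  rewrite hD !hZ !scalarfD // !scalarfZ // conjCi.
  transitivity (h v v + 'i * (h v w - h w v) - 'i * 'i * h w w); first by ring.
  by rewrite -expr2 sqrCi mulN1r opprK.
rewrite E !rmorphD rmorphM rmorphB /= !real conjCi in e2.
have {e1}e1 : (h v w)^* + (h w v)^* = h v w + h w v.
  have -> : (h v w)^* + (h w v)^* = (h v v + (h v w)^* + ((h w v)^* + h w w)) - h v v - h w w
    by ring.
  by rewrite e1; ring.
have {e2}e2 : 'i * ((h w v)^* - (h v w)^*) = 'i * (h v w - h w v).
  transitivity (h v v + - 'i * ((h v w)^* - (h w v)^*) + h w w - h v v - h w w); first by ring.
  by rewrite e2; ring.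
have {}e2 := mulfI (neq0Ci _) e2.
have : 2%:R * (h v w)^* = 2%:R * h w v.
  transitivity ((h v w)^* + (h w v)^* - ((h w v)^* - (h v w)^*)); first by ring.
  by rewrite e1 e2; ring.
by move=> /mulfI ->; rewrite ?pnatr_eq0.
Qed.

(** Gram-Schmidt by induction on the dimension: normalise one vector [u] of [W], then recurse in the
    kernel of [h u] on [W]. *)
Lemma orthonormal_basis (C : numClosedFieldType) (V : vectType C) (h : V -> V -> C) :
  (forall v, scalar (h v)) -> (forall v w, h w v = (h v w)^*) ->
  (forall v, v != 0 -> 0 < h v v) ->
  forall W : {vspace V}, exists e : 'I_(\dim W) -> V,
   [/\ forall i, e i \in W, forall i j, h (e i) (e j) = (i == j)%:R &
       forall w, w \in W -> \sum_i h (e i) w *: e i = w].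
Proof.
move=> hs hc hp W; move: {-1}(\dim W) (erefl (\dim W)) => n.
elim: n => [|n IH] in W *.
  move=> /eqP; rewrite dimv_eq0 => /eqP W0; exists (fun=> 0); split.
  - by case.
  - by case.
  - by move=> w; rewrite W0 memv0 => /eqP->; rewrite big_ord0.
move=> dW; pose v := vpick W.
have v0 : v != 0 by rewrite vpick0 -dimv_eq0 dW.
pose u := (sqrtC (h v v))^-1 *: v.
have uW : u \in W by rewrite memvZ // memv_pick.
have huu : h u u = 1.
  have p := hp _ v0; rewrite {2}/u scalarfZ // (hc v u) /u scalarfZ // rmorphM /=.
  have -> : (h v v)^* = h v v by apply/CrealP; rewrite realE ltW.
  have -> : ((sqrtC (h v v))^-1)^* = (sqrtC (h v v))^-1.
    by apply/CrealP; rewrite realE invr_ge0 sqrtC_ge0 ltW.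
  by rewrite mulrA -invfM -expr2 sqrtCK mulVf // gt_eqF.
pose L := HB.pack_for {linear V -> C^o} (h u) (GRing.isLinear.Build _ _ _ _ _ (hs u)).
pose W' := (W :&: lker (linfun L))%VS.
have W'P w : (w \in W') = (w \in W) && (h u w == 0).
  by rewrite memv_cap memv_ker lfunE.
(* Rank-nullity: [h u u = 1] makes the image of [W] a line, so exactly one dimension is lost. *)
have dW' : \dim W' = n.
  have := limg_ker_dim (linfun L) W; rewrite dW -/W'.
  suff -> : \dim (linfun L @: W) = 1 by rewrite addn1 => -[].
  apply/eqP; rewrite eqn_leq; apply/andP; split.
    by apply: leq_trans (dimvS (subvf _)) _; rewrite dimvf.
  rewrite lt0n dimv_eq0; apply: contraNneq (oner_neq0 C) => e.
  have := memv_img (linfun L) uW; rewrite e memv0 lfunE /= => /eqP <-.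
  by rewrite huu.
have [e [eW eo es]] := IH W' dW'.
have eu i : h u (e i) = 0 by have := eW i; rewrite W'P => /andP[_ /eqP].
exists (fun i => oapp e u (unlift ord0 i)); split.
- move=> i; case: unliftP => [j _|_] //=.
  by have := eW j; rewrite W'P => /andP[].
- move=> i j; case: unliftP => [i' ->|->] /=; case: unliftP => [j' ->|->] /=.
  + by rewrite eo (inj_eq lift_inj).
  + by rewrite hc eu conjC0.
  + by rewrite eu.
  + by rewrite huu.
move=> w wW; rewrite big_ord_recl unlift_none /=.
under eq_bigr => i _ do rewrite liftK /=.
have : w - h u w *: u \in W'.
  rewrite W'P; apply/andP; split; first by rewrite memvB // memvZ.
  by rewrite scalarfB // scalarfZ // huu mulr1 subrr.
move=> /es wE; rewrite -[RHS](subrK (h u w *: u)) -[in RHS]wE addrC; congr (_ + _).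
by apply: eq_bigr => i _; rewrite scalarfB // scalarfZ // (hc u) eu conjC0 mulr0 subr0.
Qed.

(** * Matrix corepresentations *)

Section StarAlgebra.
Variables (R : realType) (A : cstarAlg R).

Lemma star0 : star (0 : A) = 0.
Proof. by apply: (addrI (star (0 : A))); rewrite -starD !addr0. Qed.

Lemma star1 : star (1 : A) = 1.
Proof. by rewrite -[RHS]starK -[star 1 in RHS]mulr1 starM !starK mulr1. Qed.

Lemma star_sum (I : Type) (s : seq I) (P : pred I) (F : I -> A) :
  star (\sum_(i <- s | P i) F i) = \sum_(i <- s | P i) star (F i).
Proof. by elim/big_rec2: _ => [|i x y _ <-]; rewrite ?star0 ?starD. Qed.

Lemma starB (x y : A) : star (x - y) = star x - star y.
Proof. by rewrite -scaleN1r starD starZ rmorphN1 scaleN1r. Qed.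

End StarAlgebra.

Section MatrixCorepresentations.
Variables (R : realType) (G : fqgroup R).
Local Notation C := R[i].
Local Notation star := (@star R G).

Lemma slice_swap (V : vectType C) (phi : V -> C) (psi : G -> C) (t : tens V G) :
  scalar phi -> scalar psi -> psi (slicel phi t) = phi (slicer psi t).
Proof.
move=> hphi hpsi; elim/tens_ind: t => [|s t hs ht|u v].
- by rewrite !linear0 !scalarf0.
- by rewrite !linearD !scalarfD // hs ht.
by rewrite slicel_ptens // slicer_ptens // !scalarfZ // mulrC.
Qed.

Lemma tmul_sum (I J : finType) (x y : I -> G) (z w : J -> G) :
  tmul (\sum_i ptens (x i) (y i)) (\sum_j ptens (z j) (w j)) =
  \sum_i \sum_j ptens (x i * z j) (y i * w j).
Proof.
have inner (a b : G) : tlift (fun c d => ptens (a * c) (b * d)) (\sum_j ptens (z j) (w j)) =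
    \sum_j ptens (a * z j) (b * w j).
  rewrite linear_sum; apply: eq_bigr => j _ /=; rewrite tlift_ptens //.
  split=> [u k u1 u2|u k u1 u2] /=.
    by rewrite mulrDr -scalerAr ptensDl ptensZl.
  by rewrite mulrDr -scalerAr ptensDr ptensZr.
rewrite /tmul linear_sum; apply: eq_bigr => i _ /=; rewrite tlift_ptens; first exact: inner.
split=> [u k u1 u2|u k u1 u2] /=; rewrite !inner scaler_sumr -big_split; apply: eq_bigr => j _ /=.
  by rewrite mulrDl -scalerAl ptensDl ptensZl.
by rewrite mulrDl -scalerAl ptensDr ptensZr.
Qed.

(** [tstar] is defined through [fbasis]; antilinear expansion shows that it acts leg by leg on
    elementary tensors. *)
Lemma tstar_sum (I : finType) (x y : I -> G) :
  tstar (\sum_i ptens (x i) (y i)) = \sum_i ptens (star (x i)) (star (y i)).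
Proof.
have expand (u : G) : \sum_(i < \dim {:G}) (coord (fbasis G) i u)^* *: star (fbasis G)`_i =
  star u.
  by rewrite -[in RHS](fbasisE u) star_sum; apply: eq_bigr => i _; rewrite starZ.
have tstarp (u v : G) : tstar (ptens u v) = ptens (star u) (star v).
  rewrite -(expand u) -(expand v) ptens_suml /tstar; apply: eq_bigr => i _.
  rewrite ptens_sumr; apply: eq_bigr => j _.
  by rewrite mxE ptensZl ptensZr scalerA rmorphM.
elim/big_rec2: _ => [|i s t _ <-].
  rewrite /tstar big1 // => i _; rewrite big1 // => j _.
  by rewrite mxE conjC0 scale0r.
rewrite -tstarp /tstar -big_split; apply: eq_bigr => j _ /=.
by rewrite -big_split; apply: eq_bigr => k _ /=; rewrite !mxE rmorphD scalerDl.
Qed.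

(** Sweedler calculus, with explicit finite sums in the role of a_1 (x) a_2. *)
Lemma DeltaM_sum (f g : G) (I J : finType) (x y : I -> G) (z w : J -> G) :
  Delta f = \sum_i ptens (x i) (y i) -> Delta g = \sum_j ptens (z j) (w j) ->
  Delta (f * g) = \sum_i \sum_j ptens (x i * z j) (y i * w j).
Proof. by move=> hf hg; rewrite DeltaM hf hg tmul_sum. Qed.

Lemma Delta_star_sum (f : G) (I : finType) (x y : I -> G) :
  Delta f = \sum_i ptens (x i) (y i) ->
  Delta (star f) = \sum_i ptens (star (x i)) (star (y i)).
Proof. by move=> hf; rewrite Delta_star hf tstar_sum. Qed.

Definition mcorep d (rho : 'I_d -> 'I_d -> G) : Prop :=
  (forall i j, Delta (rho i j) = \sum_k ptens (rho i k) (rho k j)) /\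
  (forall i j, counit (rho i j) = (i == j)%:R).

(** Only one of the two unitarity identities; the other one is derived in [munitary_inv]. *)
Definition munitary d (rho : 'I_d -> 'I_d -> G) : Prop :=
  forall j l, \sum_i star (rho i j) * rho i l = (j == l)%:R.

(** Coassociativity and the counit axiom at [e j], read off by [phi i]. The family [e] may span a
    proper subspace of [V]: [K0] applies this to an invariant subspace of the function algebra. *)
Lemma corep_mcorep (V : vectType C) (kappa : {linear V -> tens V G}) d
    (e : 'I_d -> V) (phi : 'I_d -> V -> C) (rho : 'I_d -> 'I_d -> G) :
  is_corep kappa -> (forall i, scalar (phi i)) ->
  (forall i j, phi i (e j) = (i == j)%:R) ->
  (forall j, kappa (e j) = \sum_i ptens (e i) (rho i j)) -> mcorep rho.
Proof.
move=> [hassoc hcounit] hphi hpe hk.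
have pick (W : lmodType C) i (F : 'I_d -> W) : \sum_k phi i (e k) *: F k = F i.
  rewrite (bigD1 i) //= hpe eqxx scale1r big1 ?addr0 // => k nk.
  by rewrite hpe eq_sym (negPf nk) scale0r.
split=> i j.
  have := hassoc (e j); rewrite hk !tmap_sum tassoc_sum /=.
  under eq_bigr => k _.
    rewrite hk ptens_suml tassoc_sum.
    under eq_bigr => l _ do rewrite tassoc_ptens3.
    over.
  move=> /(congr1 (slicel (phi i))); rewrite exchange_big /=.
  under eq_bigr => k _ do rewrite -ptens_sumr.
  by rewrite !slicel_sum // !pick.
have hc : scalar (counit : G -> C) by exact: linear_scalar.
have := congr1 (phi i) (hcounit (e j)); rewrite hk slicer_sum // scalarf_sum // hpe => <-.
rewrite -[LHS](pick C^o i (fun k => counit (rho k j))); apply: eq_bigr => k _.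
by rewrite scalarfZ // mulrC.
Qed.

Section Coefficients.
Variables (d : nat) (rho : 'I_d -> 'I_d -> G).
Hypothesis rho_corep : mcorep rho.

Lemma mcorep_antipodel i j : \sum_k antipode (rho i k) * rho k j = (i == j)%:R.
Proof.
have := antipode_l (rho i j); rewrite rho_corep.1 rho_corep.2 linear_sum /= scaler_nat => <-.
apply: eq_bigr => k _; rewrite tlift_ptens //; split=> [u c u1 u2|u c u1 u2] /=.
  by rewrite linearP mulrDl -scalerAl.
by rewrite mulrDr -scalerAr.
Qed.

Lemma mcorep_antipoder i j : \sum_k rho i k * antipode (rho k j) = (i == j)%:R.
Proof.
have := antipode_r (rho i j); rewrite rho_corep.1 rho_corep.2 linear_sum /= scaler_nat => <-.
apply: eq_bigr => k _; rewrite tlift_ptens //; split=> [u c u1 u2|u c u1 u2] /=.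
  by rewrite mulrDl -scalerAl.
by rewrite linearP mulrDr -scalerAr.
Qed.

(* The antipode provides a right inverse of the matrix [rho], which has to
   coincide with the left inverse provided by unitarity. *)
Lemma munitary_inv : munitary rho ->
  forall i j, \sum_k rho i k * star (rho j k) = (i == j)%:R.
Proof.
move=> hu i j.
pose P : 'M[G]_d := \matrix_(i, j) rho i j.
pose Q : 'M[G]_d := \matrix_(i, j) star (rho j i).
pose A : 'M[G]_d := \matrix_(i, j) antipode (rho i j).
have QP : Q *m P = 1%:M.
  by apply/matrixP=> k l; rewrite !mxE -hu; apply: eq_bigr => m _; rewrite !mxE.
have PA : P *m A = 1%:M.
  by apply/matrixP=> k l; rewrite !mxE -mcorep_antipoder; apply: eq_bigr => m _; rewrite !mxE.
have QA : Q = A by rewrite -[Q]mulmx1 -PA mulmxA QP mul1mx.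
have /matrixP/(_ i j) : P *m Q = 1%:M by rewrite QA.
by rewrite !mxE => <-; apply: eq_bigr => m _; rewrite !mxE.
Qed.

End Coefficients.

End MatrixCorepresentations.

(** * The Haar state is faithful *)

Section States.
Variables (R : realType) (A : cstarAlg R).
Local Notation C := R[i].
Variable phi : A -> C.
Hypothesis phi_scalar : scalar phi.
Hypothesis phi_ge0 : forall x, 0 <= phi (star x * x).

Definition stform (x y : A) : C := phi (star x * y).

Lemma stform_scalar x : scalar (stform x).
Proof. by move=> a u v; rewrite /stform mulrDr -scalerAr phi_scalar. Qed.

(** Polarisation of a positive form. In particular [phi (star y)] is the conjugate of [phi y]. *)
Lemma stform_conj x y : stform y x = (stform x y)^*.
Proof.
move: x y; apply: herm_of_ge0 => [|u v w|a u w|v]; rewrite /stform.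
- exact: stform_scalar.
- by rewrite starD mulrDl scalarfD.
- by rewrite starZ -scalerAl scalarfZ.
- exact: phi_ge0.
Qed.

End States.

Section Haar.
Variables (R : realType) (G : fqgroup R).
Local Notation C := R[i].
Local Notation star := (@star R G).
Variable pi : {linear G -> C^o}.
Hypothesis pi_haar : is_haar pi.

Let pi_scalar : scalar (pi : G -> C).
Proof. exact: linear_scalar. Qed.

Lemma haar1 : pi 1 = 1 :> C. Proof. exact: pi_haar.1.1. Qed.

Lemma haar_ge0 x : 0 <= (pi (star x * x) : C). Proof. exact: pi_haar.1.2. Qed.

Lemma haar_invr (I : finType) (f : G) (x y : I -> G) :
  Delta f = \sum_i ptens (x i) (y i) -> \sum_i (pi (y i) : C) *: x i = (pi f : C) *: 1.
Proof. by move=> hf; have [<- _] := pi_haar.2 f; rewrite hf slicer_sum. Qed.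

Lemma haar_invl (I : finType) (f : G) (x y : I -> G) :
  Delta f = \sum_i ptens (x i) (y i) -> \sum_i (pi (x i) : C) *: y i = (pi f : C) *: 1.
Proof. by move=> hf; have [_ <-] := pi_haar.2 f; rewrite hf slicel_sum. Qed.

Lemma Delta_fbasis (a : G) :
  Delta a = \sum_(i < \dim {:G}) ptens (fbasis G)`_i (slicel (coord (fbasis G) i) (Delta a)).
Proof.
apply: tens_expand_slicel => [i|u]; [exact: coord_scalar|exact: fbasisE].
Qed.

Lemma mull_scalar (phi : G -> C) (x : G) : scalar phi -> scalar (fun y => phi (x * y)).
Proof. by move=> h a u v; rewrite mulrDr -scalerAr h. Qed.

Lemma Delta_is_corep : is_corep (@Delta R G).
Proof. by split; [exact: coassoc|exact: counit_r]. Qed.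

Lemma counit_scalar : scalar (counit : G -> C).
Proof. exact: linear_scalar. Qed.

(** Right invariance at each [rho k j * a], multiplied on the left by [antipode (rho i k)] and
    summed over [k]: the antipode cancels the first leg of [rho]. *)
Lemma haar_strong_inv d (rho : 'I_d -> 'I_d -> G) (rho_corep : mcorep rho) a i j :
  slicer (fun y => pi (rho i j * y) : C) (Delta a) =
  \sum_k (pi (rho k j * a) : C) *: antipode (rho i k).
Proof.
pose x (m : 'I_(\dim {:G})) := (fbasis G)`_m; pose y m := slicel (coord (fbasis G) m) (Delta a).
have Da := Delta_fbasis a; rewrite -/x -/y in Da.
have inv k : \sum_l \sum_m (pi (rho l j * y m) : C) *: (rho k l * x m) = (pi (rho k j * a) : C)
  *: 1.
  rewrite pair_big /=;
    apply: (haar_invr (x := fun p => rho k p.1 * x p.2) (y := fun p => rho p.1 j * y p.2)).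
  by rewrite (DeltaM_sum (rho_corep.1 k j) Da) pair_big.
transitivity (\sum_k antipode (rho i k) * ((pi (rho k j * a) : C) *: 1)); last first.
  by apply: eq_bigr => k _; rewrite -scalerAr mulr1.
under [RHS]eq_bigr => k _.
  rewrite -inv mulr_sumr.
  under eq_bigr => l _ do rewrite mulr_sumr.
  over.
rewrite exchange_big /= Da slicer_sum; last exact: mull_scalar.
transitivity (\sum_l \sum_m (pi (rho l j * y m) : C) *: ((i == l)%:R * x m)).
  rewrite [RHS](bigD1 i) //= [X in _ + X]big1 ?addr0 => [|l nl].
    by apply: eq_bigr => m _; rewrite eqxx mul1r.
  by rewrite big1 // => m _; rewrite eq_sym (negPf nl) mul0r scaler0.
apply: eq_bigr => l _; rewrite exchange_big /=; apply: eq_bigr => m _.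
rewrite -(mcorep_antipodel rho_corep) mulr_suml scaler_sumr; apply: eq_bigr => k _.
by rewrite -scalerAr mulrA.
Qed.

(** The counit applied to the first leg puts each [e j] in the span of the coefficients. *)
Lemma mcorep_spans d (e : 'I_d -> G) (rho : 'I_d -> 'I_d -> G) :
  (forall j, Delta (e j) = \sum_i ptens (e i) (rho i j)) ->
  forall j, e j = \sum_i (counit (e i) : C) *: rho i j.
Proof. by move=> h j; rewrite -[LHS]counit_l h slicel_sum //; exact: counit_scalar. Qed.

Lemma haar_nondegenerate (a : G) : (forall y, pi (y * a) = 0 :> C) -> a = 0.
Proof.
pose b := fbasis G; pose r i (j : 'I_(\dim {:G})) := slicel (coord b i) (Delta b`_j).
have Db (j : 'I_(\dim {:G})) : Delta b`_j = \sum_(i < \dim {:G}) ptens b`_i (r i j)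
  by exact: Delta_fbasis.
have rcorep : mcorep r.
  apply: (corep_mcorep Delta_is_corep (@coord_scalar _ _)) => [i j|j]; last exact: Db.
  exact: coord_fbasis.
have bE := mcorep_spans Db.
pose N c := forall y, pi (y * c) = 0 :> C.
pose D c m := slicel (coord b m) (Delta c).
(* Strong invariance kills the slice of [Delta c] against each [r i j]; independence of [b] then
   kills every term, and the [r i j] span by [bE]. *)
have ND c m : N c -> N (D c m).
  move=> Nc; have Nr i j : pi (r i j * D c m) = 0 :> C.
    have := haar_strong_inv rcorep c i j.
    rewrite [RHS]big1 => [|k _]; last by rewrite Nc scale0r.
    rewrite {1}(Delta_fbasis c) slicer_sum; last exact: mull_scalar.
    by move=> /(congr1 (coord b m)); rewrite linear0 coord_sum_free ?(basis_free (vbasisP _)).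
  move=> y; rewrite -(fbasisE y) mulr_suml linear_sum big1 // => j _.
  rewrite -scalerAl linearZ /= [(fbasis G)`_j]bE mulr_suml linear_sum big1 ?scaler0 // => i _.
  by rewrite -scalerAl linearZ /= Nr scaler0.
(* Apply [pi] to the antipode axiom for [c]: each term on the left is a multiple of a null slice,
   while the right side gives [counit c]. *)
have eps0 (c : G) : N c -> counit c = 0 :> C.
  move=> Nc; rewrite -[LHS]mulr1 -haar1 -scalarfZ // -antipode_l (Delta_fbasis c).
  rewrite tlift_sum; last first.
    split=> [u k u1 u2|u k u1 u2] /=; first by rewrite linearP mulrDl -scalerAl.
    by rewrite mulrDr -scalerAr.
  by rewrite linear_sum big1 // => m _; apply: ND.
move=> Na; rewrite -[a]counit_r (Delta_fbasis a) slicer_sum; last exact: counit_scalar.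
by rewrite big1 // => m _; rewrite eps0 ?scale0r //; exact: ND.
Qed.

(** Cauchy-Schwarz against [star y] gives [pi (y * a) = 0] for every [y]. *)
Lemma haar_faithful (a : G) : pi (star a * a) = 0 :> C -> a = 0.
Proof.
move=> ha; apply: haar_nondegenerate => y.
have h1 := stform_scalar pi_scalar; have h2 := stform_conj pi_scalar haar_ge0.
have := herm_CauchySchwarz h1 h2 haar_ge0 (star y) a.
rewrite /stform ha mulr0 starK => le; apply/eqP.
by rewrite -normr_eq0 -sqrf_eq0 eq_le le exprn_ge0.
Qed.

Lemma haar_posdef (v : G) : v != 0 -> 0 < stform pi v v.
Proof.
move=> v0; rewrite lt_def haar_ge0 andbT; apply: contra_neq v0; exact: haar_faithful.
Qed.

(** Left invariance at w_j^* w_l: orthonormality of [w] collapses the double sum to an entry of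
    rho^* rho. *)
Lemma haar_munitary d (w : 'I_d -> G) (rho : 'I_d -> 'I_d -> G) :
  (forall i j, stform pi (w i) (w j) = (i == j)%:R) ->
  (forall j, Delta (w j) = \sum_i ptens (w i) (rho i j)) -> munitary rho.
Proof.
move=> w_ortho Dw j l.
have := DeltaM_sum (Delta_star_sum (Dw j)) (Dw l); rewrite pair_big /= => D.
have := haar_invl D; rewrite -(pair_big xpredT xpredT (fun i k =>
  (pi (star (w i) * w k) : C) *: (star (rho i j) * rho k l))) /=.
rewrite -/(stform pi (w j) (w l)) w_ortho scaler_nat => <-; apply: eq_bigr => i _.
rewrite (bigD1 i) //= -/(stform pi (w i) (w i)) w_ortho eqxx scale1r.
rewrite [X in _ + X]big1 ?addr0 // => k nk.
by rewrite -/(stform pi (w i) (w k)) w_ortho eq_sym (negPf nk) scale0r.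
Qed.

End Haar.

(** * The Haar state is tracial *)

Section HaarTrace.
Variables (R : realType) (G : fqgroup R).
Local Notation C := R[i].
Local Notation star := (@star R G).
Variable pi : {linear G -> C^o}.
Hypothesis pi_haar : is_haar pi.

Let pi_scalar : scalar (pi : G -> C).
Proof. exact: linear_scalar. Qed.
Local Notation h := (stform (pi : G -> C)).
Let h_scalar := stform_scalar pi_scalar.
Let h_conj := stform_conj pi_scalar (haar_ge0 pi_haar).

Variables (n : nat) (y : 'I_n -> G).
Hypothesis y_ortho : forall i j, h (y i) (y j) = (i == j)%:R.
Hypothesis y_span : forall x, \sum_i h (y i) x *: y i = x.

Let r i j := slicel (h (y i)) (Delta (y j)).

Let Dy j : Delta (y j) = \sum_i ptens (y i) (r i j).
Proof. exact: tens_expand_slicel. Qed.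

Let r_corep : mcorep r.
Proof. exact: (corep_mcorep (@Delta_is_corep R G) (fun i => h_scalar (y i)) y_ortho Dy). Qed.

Let r_unitary : munitary r.
Proof. exact: haar_munitary y_ortho Dy. Qed.

Let L (x : G) i j := h (y i) (x * y j).

Let LE x j : x * y j = \sum_i L x i j *: y i.
Proof. by rewrite -[LHS]y_span. Qed.

(** The unnormalised trace of the left regular representation. *)
Let tr (x : G) : C := \sum_i L x i i.

Let tr_scalar : scalar tr.
Proof.
move=> a u v; rewrite /tr mulr_sumr -big_split; apply: eq_bigr => i _ /=.
by rewrite /L mulrDl -scalerAl h_scalar.
Qed.

Let trC u v : tr (u * v) = tr (v * u).
Proof.
have E a b : tr (a * b) = \sum_i \sum_j L b j i * L a i j.
  apply: eq_bigr => i _; rewrite [LHS]/L -mulrA LE mulr_sumr scalarf_sum //.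
  by apply: eq_bigr => j _; rewrite -scalerAr scalarfZ.
rewrite !E exchange_big; apply: eq_bigr => i _; apply: eq_bigr => j _.
by rewrite mulrC.
Qed.

Let tr1 : tr 1 = n%:R.
Proof.
rewrite /tr (eq_bigr (fun _ => 1)) => [|i _]; first by rewrite sumr_const card_ord.
by rewrite /L mul1r y_ortho eqxx.
Qed.

Let tr_star_mul x : tr (star x * x) = \sum_i h (x * y i) (x * y i).
Proof. by apply: eq_bigr => i _; rewrite /L /stform starM !mulrA. Qed.

Let tr_ge0 x : 0 <= tr (star x * x).
Proof. by rewrite tr_star_mul sumr_ge0 // => i _; exact: haar_ge0. Qed.

(** Each [x * y i] is a null vector of the faithful [pi], hence zero, and 1 is a combination of the
    [y i]. *)
Let tr_faithful x : tr (star x * x) = 0 -> x = 0.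
Proof.
rewrite tr_star_mul => /eqP; rewrite psumr_eq0 => [/allP x0|i _]; last exact: haar_ge0.
rewrite -[x]mulr1 -(y_span 1) mulr_sumr big1 // => i _.
rewrite -scalerAr (haar_faithful pi_haar (a := x * y i)) ?scaler0 //.
by apply/eqP; apply: x0; rewrite mem_index_enum.
Qed.

Let n_neq0 : n%:R != 0 :> C.
Proof.
rewrite pnatr_eq0; apply/eqP => n0; have := oner_neq0 G.
by rewrite -(y_span 1) big1 ?eqxx // => i _; by have := ltn_ord i;
  rewrite [X in (_ < X)%N -> _]n0.
Qed.

(* With [[x]_ij = L x i j] the matrix of left multiplication by [x], comparing
   [Delta (a y_j)] with [Delta a * Delta y_j] gives
   [([a_1] (x) a_2) r = r [a]]; multiply by the inverse of [r] and take traces. *)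
Let tr_conv a : tr (slicel tr (Delta a)) = tr a * n%:R.
Proof.
pose x (i : 'I_(\dim {:G})) := (fbasis G)`_i.
pose z i := slicel (coord (fbasis G) i) (Delta a).
have Da : Delta a = \sum_p ptens (x p) (z p) by exact: Delta_fbasis.
have key m j : \sum_p \sum_k L (x p) m k *: (z p * r k j) = \sum_i L a i j *: r m i.
  have := DeltaM_sum Da (Dy j); rewrite LE linear_sum pair_big /=.
  move=> /(congr1 (slicel (h (y m)))); rewrite slicel_sum // pair_big /= => <-.
  rewrite linear_sum; apply: eq_bigr => i _; rewrite !linearZ /=.
  by [].
(* Cancels [r] in [key] by multiplying on the right with its adjoint, an inverse by
   [munitary_inv]. *)
have key2 m m' : \sum_p L (x p) m m' *: z p = \sum_i \sum_j L a i j *: (r m i * star (r m' j)).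
  have inv := munitary_inv r_corep r_unitary.
  rewrite exchange_big /=.
  transitivity (\sum_j (\sum_p \sum_k L (x p) m k *: (z p * r k j)) * star (r m' j)); last first.
    apply: eq_bigr => j _; rewrite key mulr_suml; apply: eq_bigr => i _.
    by rewrite -scalerAl.
  under [RHS]eq_bigr => j _ do rewrite mulr_suml.
  rewrite exchange_big /=; apply: eq_bigr => p _.
  under [RHS]eq_bigr => j _ do rewrite mulr_suml.
  rewrite exchange_big /=.
  transitivity (\sum_k L (x p) m k *: (z p * (k == m')%:R)).
    rewrite (bigD1 m') //= eqxx mulr1 big1 ?addr0 // => k nk.
    by rewrite (negPf nk) mulr0 scaler0.
  apply: eq_bigr => k _; rewrite -inv mulr_sumr scaler_sumr; apply: eq_bigr => j _.
  by rewrite -scalerAl mulrA.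
rewrite Da slicel_sum //.
have -> : \sum_p tr (x p) *: z p = \sum_i \sum_j L a i j *: \sum_m r m i * star (r m j).
  rewrite /tr; under eq_bigr => p _ do rewrite scaler_suml.
  rewrite exchange_big /=; under eq_bigr => m _ do rewrite key2.
  rewrite exchange_big; apply: eq_bigr => i _; rewrite exchange_big; apply: eq_bigr => j _ /=.
  by rewrite scaler_sumr.
(* Cyclicity of [tr] turns r_mi r_mj^* into r_mj^* r_mi, whose sum over m is a Kronecker delta by
   unitarity. *)
rewrite scalarf_sum // {2}/tr mulr_suml; apply: eq_bigr => i _.
rewrite scalarf_sum // (bigD1 i) //= [X in _ + X]big1 ?addr0 => [|j nj].
  rewrite scalarfZ // scalarf_sum // (eq_bigr (fun m => tr (star (r m i) * r m i))) => [|m _].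
    by rewrite -scalarf_sum // r_unitary eqxx tr1.
  by rewrite trC.
rewrite scalarfZ // scalarf_sum // (eq_bigr (fun m => tr (star (r m j) * r m i))) => [|m _].
  by rewrite -scalarf_sum // r_unitary (negPf nj) scalarf0 // mulr0.
by rewrite trC.
Qed.

(* The normalised regular trace is idempotent for convolution, so the matrix
   [(tr r_ij / n)] is idempotent;
     unitarity of [r] forces its range to consist of fixed vectors. *)
Let tr_invr a : slicer tr (Delta a) = tr a *: 1.
Proof.
have Eidem i k : \sum_j tr (r i j) * tr (r j k) = n%:R * tr (r i k).
  rewrite mulrC -tr_conv r_corep.1 slicel_sum // scalarf_sum //.
  by apply: eq_bigr => j _; rewrite scalarfZ.
have fixed i k : \sum_j tr (r j k) *: r i j = tr (r i k) *: 1.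
  pose X i := \sum_j tr (r j k) *: r i j.
  have tX i' : tr (X i') = n%:R * tr (r i' k).
    by rewrite scalarf_sum // -Eidem; apply: eq_bigr => j _; rewrite scalarfZ // mulrC.
  (* [X] is the image under [r] of a column of the matrix of traces; unitarity preserves its length,
     and [tr 1] supplies the factor [n]. *)
  have sX : \sum_i' tr (star (X i') * X i') = n%:R * \sum_i' (tr (r i' k))^* * tr (r i' k).
    rewrite -scalarf_sum //.
    have -> : \sum_i' star (X i') * X i' =
      \sum_j \sum_l ((tr (r j k))^* * tr (r l k)) *: \sum_i' star (r i' j) * r i' l.
      rewrite /X; under eq_bigr => i' _.
        rewrite star_sum mulr_suml.
        under eq_bigr => j _.
          rewrite mulr_sumr; under eq_bigr => l _ do rewrite starZ -scalerAl -scalerAr scalerA.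
          over.
        over.
      rewrite exchange_big; apply: eq_bigr => j _; rewrite exchange_big; apply: eq_bigr => l _ /=.
      by rewrite scaler_sumr.
    rewrite scalarf_sum // mulr_sumr; apply: eq_bigr => j _; rewrite scalarf_sum // (bigD1 j) //=.
    rewrite r_unitary eqxx scalarfZ // tr1 big1 ?addr0 => [|l nl]; first by rewrite mulrC.
    by rewrite r_unitary eq_sym (negPf nl) scaler0 scalarf0.
  have t_conj := stform_conj tr_scalar tr_ge0.
  have t_scalar := stform_scalar tr_scalar.
  (* Pythagoras for the projection of [X i'] onto the scalars, using [tX]. By [sX] the sum over [i']
     of these squared distances is zero. *)
  have E i' : tr (star (X i' - tr (r i' k) *: 1) * (X i' - tr (r i' k) *: 1)) =
     tr (star (X i') * X i') - n%:R * ((tr (r i' k))^* * tr (r i' k)).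
    set c := tr (r i' k); set u := X i';
      rewrite -[LHS]/(stform tr (u - c *: 1) (u - c *: 1)) -scaleNr.
    have e1 : stform tr 1 u = n%:R * c by rewrite /stform star1 mul1r tX.
    have e2 : stform tr 1 1 = n%:R by rewrite /stform star1 mul1r tr1.
    have e3 : stform tr u 1 = n%:R * c^* by rewrite t_conj e1 rmorphM /= conjC_nat.
    rewrite scalarfD // scalarfZ // !hermDl // !hermZl // e1 e2 e3 rmorphN /= -/(stform tr u u).
    by ring.
  have Z : forall i', X i' - tr (r i' k) *: 1 = 0.
    have S0 : \sum_i' tr (star (X i' - tr (r i' k) *: 1) * (X i' - tr (r i' k) *: 1)) = 0.
      rewrite (eq_bigr _ (fun i' _ => E i')) sumrB sX -mulr_sumr subrr //.
    move/eqP: S0; rewrite psumr_eq0 => [/allP x0 i'|i' _]; last exact: tr_ge0.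
    by apply: tr_faithful; apply/eqP; apply: x0; rewrite mem_index_enum.
  by apply/eqP; rewrite -subr_eq0 Z.
(* The invariance identity now holds on the coefficients [r i k], and these span by
   [mcorep_spans]. *)
pose f : {linear G -> G} := @slicer _ G G tr \o Delta.
have fr i k : f (r i k) = tr (r i k) *: 1 by rewrite /f /= r_corep.1 slicer_sum // fixed.
have fy k : f (y k) = tr (y k) *: 1.
  rewrite (mcorep_spans Dy k) linear_sum scalarf_sum // scaler_suml; apply: eq_bigr => i _.
  by rewrite linearZ_LR fr scalarfZ // scalerA.
rewrite -[LHS]/(f a) -(y_span a) linear_sum scalarf_sum // scaler_suml; apply: eq_bigr => k _.
by rewrite linearZ_LR fy scalarfZ // scalerA.
Qed.

(** Uniqueness of invariant functionals: evaluate [pi] (x) [tr] on [Delta x], using invariance of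
    [tr] in one order of slicing and of [pi] in the other. *)
Lemma haar_regular_trace x : (pi x : C) * n%:R = \sum_i h (y i) (x * y i).
Proof.
rewrite -/(tr x); have := slice_swap (Delta x) pi_scalar tr_scalar.
rewrite tr_invr scalarfZ // haar1 // mulr1 => <-.
by have [_ ->] := pi_haar.2 x; rewrite scalarfZ // tr1.
Qed.

Lemma haar_tracial_aux u v : pi (u * v) = pi (v * u) :> C.
Proof.
by apply: (mulIf n_neq0); rewrite !haar_regular_trace; exact: trC.
Qed.

End HaarTrace.

Lemma haar_tracial (R : realType) (G : fqgroup R) (pi : {linear G -> R[i]^o}) :
  is_haar pi -> forall u v : G, pi (u * v) = pi (v * u).
Proof.
move=> pi_haar u v; have ps : scalar (pi : G -> R[i]) by exact: linear_scalar.
have [y [_ y1 y2]] := orthonormal_basis (stform_scalar ps) (stform_conj ps (haar_ge0 pi_haar))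
  (haar_posdef pi_haar) fullv.
by apply: (haar_tracial_aux pi_haar y1) => x; rewrite y2 // memvf.
Qed.

(** * Unitary corepresentations and Schur's lemma *)

Section UnitaryCorep.
Variables (R : realType) (G : fqgroup R).
Local Notation C := R[i].
Local Notation star := (@star R G).

Lemma hip_scalar (V : hilbert R) (v : V) : scalar (hip v).
Proof. by move=> a u w; rewrite /hip linearDl linearZl_LR. Qed.

Lemma hip_conj (V : hilbert R) (v w : V) : hip w v = (hip v w)^*.
Proof. by rewrite /hip hermC expr0 mul1r. Qed.

Lemma hip_gt0 (V : hilbert R) (v : V) : v != 0 -> 0 < hip v v.
Proof. exact: neq0_dnorm_gt0. Qed.

Lemma hilbert_onb (V : hilbert R) : exists e : 'I_(\dim {:V}) -> V,
  (forall i j, hip (e i) (e j) = (i == j)%:R) /\ forall v, \sum_i hip (e i) v *: e i = v.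
Proof.
have [e [_ e1 e2]] := orthonormal_basis (@hip_scalar V) (@hip_conj V) (@hip_gt0 V) fullv.
by exists e; split=> // v; rewrite e2 // memvf.
Qed.

(** A chosen orthonormal basis; the [fbasis] of the definitions is arbitrary. *)
Definition onb (V : hilbert R) : 'I_(\dim {:V}) -> V := projT1 (cid (hilbert_onb V)).
Arguments onb : clear implicits.

Lemma onb_ortho (V : hilbert R) i j : hip (onb V i) (onb V j) = (i == j)%:R.
Proof. exact: (projT2 (cid (hilbert_onb V))).1. Qed.

Lemma onb_span (V : hilbert R) v : \sum_i hip (onb V i) v *: onb V i = v.
Proof. exact: (projT2 (cid (hilbert_onb V))).2. Qed.

Lemma hip_onb_sum (V : hilbert R) i (c : 'I_(\dim {:V}) -> C) :
  hip (onb V i) (\sum_j c j *: onb V j) = c i.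
Proof.
rewrite scalarf_sum; last exact: hip_scalar.
rewrite (bigD1 i) //= scalarfZ; last exact: hip_scalar.
rewrite onb_ortho eqxx mulr1 big1 ?addr0 // => j nj.
by rewrite scalarfZ ?onb_ortho ?(eq_sym i) ?(negPf nj) ?mulr0 //; exact: hip_scalar.
Qed.

(** The matrix elements in the orthonormal basis, where [matelt] uses [fbasis]. *)
Definition coef (V : hilbert R) (kappa : {linear V -> tens V G}) i j : G :=
  slicel (hip (onb V i)) (kappa (onb V j)).

Lemma coefE (V : hilbert R) (kappa : {linear V -> tens V G}) j :
  kappa (onb V j) = \sum_i ptens (onb V i) (coef kappa i j).
Proof. by apply: tens_expand_slicel; [move=> i; exact: hip_scalar|exact: onb_span]. Qed.

(** Coefficients of [kappa] in any basis lie in the span of [coef]; [K0] uses this to carry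
    coefficients through an equivalence. *)
Lemma slicel_coef (V : hilbert R) (kappa : {linear V -> tens V G}) (theta : V -> C) v :
  scalar theta -> slicel theta (kappa v) =
  \sum_l \sum_k (hip (onb V l) v * theta (onb V k)) *: coef kappa k l.
Proof.
move=> htheta; pose S : {linear V -> G} := @slicel _ V G theta \o kappa.
rewrite -[LHS]/(S v) -{1}(onb_span v) linear_sum; apply: eq_bigr => l _.
rewrite linearZ_LR /= coefE slicel_sum // scaler_sumr; apply: eq_bigr => k _.
by rewrite scalerA.
Qed.

Lemma coef_mcorep (V : hilbert R) (kappa : {linear V -> tens V G}) :
  is_corep kappa -> mcorep (coef kappa).
Proof.
move=> hk; apply: (corep_mcorep hk (fun i => hip_scalar (onb V i)) (@onb_ortho V)).
exact: coefE.
Qed.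

(** Frees [tens_ip] from the bases of its definition, so that unitarity can be read in [onb]. *)
Lemma tens_ip_sum (V : hilbert R) (I J : finType) (u : I -> V) (a : I -> G)
    (v : J -> V) (b : J -> G) :
  tens_ip (\sum_p ptens (u p) (a p)) (\sum_q ptens (v q) (b q)) =
  \sum_p \sum_q hip (u p) (v q) *: (star (a p) * b q).
Proof.
have slice (t : tens V G) i : slicel (coord (fbasis V) i) t = \sum_(j < \dim {:G}) t i j *:
  (fbasis G)`_j.
  rewrite {1}(tens_expandl t) slicel_sum; last exact: coord_scalar.
  rewrite (bigD1 i) //= coord_fbasis eqxx scale1r [X in _ + X]big1 ?addr0 // => k nk.
  by rewrite coord_fbasis eq_sym (negPf nk) scale0r.
have ipE (s t : tens V G) : tens_ip s t = \sum_(i < \dim {:V}) \sum_(k < \dim {:V})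
   hip (fbasis V)`_i (fbasis V)`_k *:
     (star (slicel (coord (fbasis V) i) s) * slicel (coord (fbasis V) k) t).
  rewrite /tens_ip; apply: eq_bigr => i _; rewrite exchange_big; apply: eq_bigr => k _ /=.
  rewrite !slice star_sum mulr_suml scaler_sumr; apply: eq_bigr => j _.
  rewrite mulr_sumr scaler_sumr; apply: eq_bigr => l _.
  by rewrite starZ -[X in _ = _ *: X]scalerAl -[X in _ = _ *: (_ *: X)]scalerAr !scalerA;
    congr (_ *: _); ring.
rewrite ipE.
transitivity (\sum_(i < \dim {:V}) \sum_(k < \dim {:V}) \sum_p \sum_q
   ((coord (fbasis V) i (u p))^* * (coord (fbasis V) k (v q) *
      hip (fbasis V)`_i (fbasis V)`_k)) *: (star (a p) * b q)).
  apply: eq_bigr => i _; apply: eq_bigr => k _.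
  rewrite !slicel_sum; try exact: coord_scalar.
  rewrite star_sum mulr_suml scaler_sumr; apply: eq_bigr => p _.
  rewrite mulr_sumr scaler_sumr; apply: eq_bigr => q _.
  by rewrite starZ -[X in _ *: X = _]scalerAl -[X in _ *: (_ *: X) = _]scalerAr !scalerA;
    congr (_ *: _); ring.
under eq_bigr => i _ do rewrite exchange_big /=.
rewrite exchange_big; apply: eq_bigr => p _ /=.
under eq_bigr => i _ do rewrite exchange_big /=.
rewrite exchange_big; apply: eq_bigr => q _ /=.
rewrite -[in RHS](fbasisE (u p)) herm_suml; [|exact: hip_scalar|exact: hip_conj].
rewrite scaler_suml; apply: eq_bigr => i _.
rewrite hermZl; [|exact: hip_scalar|exact: hip_conj].
rewrite -[in RHS](fbasisE (v q)) scalarf_sum; last exact: hip_scalar.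
rewrite mulr_sumr scaler_suml; apply: eq_bigr => k _.
by rewrite scalarfZ //; exact: hip_scalar.
Qed.

Lemma coef_munitary (V : hilbert R) (kappa : {linear V -> tens V G}) :
  Defs.is_unitary kappa -> munitary (coef kappa).
Proof.
move=> hk j l; have := hk (onb V j) (onb V l).
rewrite !coefE tens_ip_sum onb_ortho scaler_nat => <-; apply: eq_bigr => i _.
rewrite (bigD1 i) //= onb_ortho eqxx scale1r [X in _ + X]big1 ?addr0 // => k nk.
by rewrite onb_ortho eq_sym (negPf nk) scale0r.
Qed.

Lemma is_invariantP (V : vectType C) (kappa : {linear V -> tens V G}) (W : {vspace V}) :
  is_invariant kappa W <->
  forall w, w \in W -> forall phi : G -> C, scalar phi -> slicer phi (kappa w) \in W.
Proof.
split=> h w /h; first by move=> /mem_tsubP.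
by move=> hw; apply/mem_tsubP.
Qed.

Lemma slicer_lin (V W : vectType C) (lambda : {linear V -> tens W G}) (phi : G -> C)
    (I : finType) (c : I -> C) (v : I -> V) :
  slicer phi (lambda (\sum_i c i *: v i)) = \sum_i c i *: slicer phi (lambda (v i)).
Proof.
pose S : {linear V -> W} := @slicer _ W G phi \o lambda.
by rewrite -[LHS]/(S _) linear_sum; apply: eq_bigr => i _; rewrite linearZ_LR.
Qed.

Lemma slicer_tmap (V W : vectType C) (T : {linear V -> W}) (phi : G -> C) (t : tens V G) :
  scalar phi -> slicer phi (tmap T idfun t) = T (slicer phi t).
Proof.
move=> hphi; rewrite {1}(tens_expand_slicer t) tmap_sum slicer_sum //=.
by rewrite [in RHS](tens_expand_slicer t) slicer_sum // linear_sum; apply: eq_bigr => i _;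
  rewrite linearZ.
Qed.

(** Kernel and image of an intertwiner are invariant, hence each is zero or everything. *)
Lemma schur (V W : vectType C) (kappa : {linear V -> tens V G})
    (lambda : {linear W -> tens W G}) (T : 'Hom(V, W)) :
  irreducible kappa -> irreducible lambda ->
  (forall v (phi : G -> C), scalar phi ->
     slicer phi (lambda (T v)) = T (slicer phi (kappa v))) ->
  T = 0 \/ bijective T.
Proof.
move=> [V0 Virr] [W0 Wirr] hT.
have kerI : is_invariant kappa (lker T).
  apply/is_invariantP => w; rewrite memv_ker => /eqP Tw phi hphi.
  by rewrite memv_ker -hT // Tw !linear0.
have imI : is_invariant lambda (limg T).
  apply/is_invariantP => _ /memv_imgP[v _ ->] phi hphi.
  by rewrite hT // memv_img // memvf.
have [ker0|kerf] := Virr _ kerI; last first.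
  left; apply/lfunP => v; rewrite zero_lfunE; apply/eqP.
  by rewrite -memv_ker kerf memvf.
have [im0|imf] := Wirr _ imI.
  left; apply/lfunP => v; rewrite zero_lfunE; apply/eqP.
  by rewrite -memv0 -im0 memv_img // memvf.
right; exists (T^-1)%VF; first by apply: lker0_lfunK; rewrite ker0.
by move=> w; rewrite limg_lfunVK // imf memvf.
Qed.

(** * Schur's lemma for coefficient matrices *)

Section SchurMatrix.
Variables (V W : hilbert R) (kappa : {linear V -> tens V G}) (lambda : {linear W -> tens W G}).
Hypotheses (kappa_irr : irreducible kappa) (lambda_irr : irreducible lambda).

(** The hypothesis says that the linear map with matrix [Z] in the orthonormal bases intertwines
    [kappa] and [lambda], so [schur] applies to it. *)
Lemma schur_mx (Z : 'I_(\dim {:W}) -> 'I_(\dim {:V}) -> C) :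
  (forall k p, \sum_n Z n p *: coef lambda k n = \sum_i Z k i *: coef kappa i p) ->
  (forall n p, Z n p = 0) \/ exists T : 'Hom(V, W),
    [/\ forall p, T (onb V p) = \sum_n Z n p *: onb W n, bijective T & equivalent kappa lambda].
Proof.
move=> hZ.
pose f (w : V) : W := \sum_p hip (onb V p) w *: \sum_n Z n p *: onb W n.
have f_lin : linear f.
  move=> a u v; rewrite /f scaler_sumr -big_split; apply: eq_bigr => p _ /=.
  by rewrite hip_scalar scalerDl scalerA.
pose L := HB.pack_for {linear V -> W} f (GRing.isLinear.Build _ _ _ _ _ f_lin).
pose T : 'Hom(V, W) := linfun L.
have TE p : T (onb V p) = \sum_n Z n p *: onb W n.
  rewrite lfunE /= /f (bigD1 p) //= onb_ortho eqxx scale1r [X in _ + X]big1 ?addr0 // => q nq.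
  by rewrite onb_ortho (negPf nq) scale0r.
have hT0 p (phi : G -> C) : scalar phi ->
     slicer phi (lambda (T (onb V p))) = T (slicer phi (kappa (onb V p))).
  move=> hphi; rewrite TE coefE slicer_sum // slicer_lin linear_sum.
  transitivity (\sum_k phi (\sum_n Z n p *: coef lambda k n) *: onb W k).
    under [RHS]eq_bigr => k _ do rewrite scalarf_sum // scaler_suml.
    rewrite exchange_big; apply: eq_bigr => n _.
    rewrite coefE slicer_sum // scaler_sumr.
    by apply: eq_bigr => k _; rewrite scalarfZ // scalerA.
  under eq_bigr => k _ do rewrite hZ scalarf_sum // scaler_suml.
  rewrite exchange_big; apply: eq_bigr => i _; rewrite linearZ_LR /= TE scaler_sumr.
  by apply: eq_bigr => k _; rewrite scalarfZ // scalerA mulrC.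
have hT v (phi : G -> C) : scalar phi ->
     slicer phi (lambda (T v)) = T (slicer phi (kappa v)).
  move=> hphi; rewrite -(onb_span v) slicer_lin [in LHS]linear_sum.
  under [in LHS]eq_bigr => p _ do rewrite linearZ_LR.
  rewrite slicer_lin linear_sum; apply: eq_bigr => p _.
  by rewrite linearZ_LR hT0.
have [T0|bT] := schur kappa_irr lambda_irr hT.
  left=> n p; have := congr1 (hip (onb W n)) (TE p).
  by rewrite hip_onb_sum => <-; rewrite T0 zero_lfunE scalarf0 //; exact: hip_scalar.
right; exists T; split=> //; exists T; split=> // v.
by apply: slicer_inj => phi hphi; rewrite slicer_tmap // hT.
Qed.

End SchurMatrix.

(** Subtracting an eigenvalue leaves an intertwiner with nonzero kernel, which must vanish. *)
Lemma schur_mx_scalar (V : hilbert R) (kappa : {linear V -> tens V G})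
    (Z : 'I_(\dim {:V}) -> 'I_(\dim {:V}) -> C) :
  irreducible kappa ->
  (forall k p, \sum_n Z n p *: coef kappa k n = \sum_i Z k i *: coef kappa i p) ->
  exists c, forall n p, Z n p = (n == p)%:R * c.
Proof.
move=> kirr hZ.
have dV : (0 < \dim {:V})%N.
  by rewrite lt0n dimv_eq0; apply/eqP; case: kirr.
(* The transpose of [Z], since eigenvectors are row vectors here. *)
pose A : 'M[C]_(\dim {:V}) := \matrix_(i, j) Z j i.
have [a /eigenvalueP [v vA v0]] := spectral.eigenvalue_closed A dV.
pose Z' n p := Z n p - (n == p)%:R * a.
have sum1 (F : 'I_(\dim {:V}) -> G) p : \sum_n ((n == p)%:R * a) *: F n = a *: F p.
  rewrite (bigD1 p) //= eqxx mul1r big1 ?addr0 // => n np.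
  by rewrite (negPf np) mul0r scale0r.
have hZ' k p : \sum_n Z' n p *: coef kappa k n = \sum_i Z' k i *: coef kappa i p.
  under eq_bigr => n _ do rewrite scalerBl.
  under [RHS]eq_bigr => n _ do rewrite scalerBl eq_sym.
  by rewrite !sumrB hZ !sum1.
have [Z0|[T [TE bT _]]] := schur_mx kirr kirr hZ'.
  by exists a => n p; apply/eqP; rewrite -subr_eq0 -/(Z' n p) Z0.
case/eqP: v0; apply/rowP => p; rewrite mxE.
pose w := \sum_p v 0 p *: onb V p.
suff w0 : w = 0 by rewrite -(hip_onb_sum p (v 0)) -/w w0 scalarf0 //; exact: hip_scalar.
apply: (bij_inj bT); rewrite linear0 linear_sum.
under eq_bigr => i _ do rewrite linearZ_LR /= TE scaler_sumr.
rewrite exchange_big big1 // => n _ /=.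
under eq_bigr => i _ do rewrite scalerA.
rewrite -scaler_suml; have /rowP/(_ n) := vA; rewrite !mxE => E.
under eq_bigr => i _ do rewrite mulrBr.
rewrite sumrB (eq_bigr (fun j => v 0 j * A j n)) => [|j _]; last by rewrite mxE.
rewrite E (bigD1 n) //= eqxx mul1r [a * _]mulrC big1 ?addr0 ?subrr ?scale0r // => i ni.
by rewrite eq_sym (negPf ni) mul0r mulr0.
Qed.

End UnitaryCorep.

Arguments onb {R} V i.

(** * Orthogonality relations *)

Section Orthogonality.
Variables (R : realType) (G : fqgroup R).
Local Notation C := R[i].
Local Notation star := (@star R G).
Variable pi : {linear G -> C^o}.
Hypothesis pi_haar : is_haar pi.

Let pi_scalar : scalar (pi : G -> C).
Proof. exact: linear_scalar. Qed.

(** Mirror image of [haar_strong_inv] for the first leg: left invariance at each rho_ik^* a, with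
    the adjoint of [rho] as its inverse in place of the antipode. *)
Lemma unitary_strong_inv d (rho : 'I_d -> 'I_d -> G) : mcorep rho -> munitary rho ->
  forall a i j, slicel (fun y => pi (star (rho i j) * y) : C) (Delta a) =
    \sum_k (pi (star (rho i k) * a) : C) *: rho j k.
Proof.
move=> rho_corep rho_unitary a i j.
have rinv := munitary_inv rho_corep rho_unitary.
pose x (m : 'I_(\dim {:G})) := (fbasis G)`_m; pose y m := slicel (coord (fbasis G) m) (Delta a).
have Da : Delta a = \sum_m ptens (x m) (y m) by exact: Delta_fbasis.
have inv k : \sum_l \sum_m (pi (star (rho i l) * x m) : C) *: (star (rho l k) * y m) =
    (pi (star (rho i k) * a) : C) *: 1.
  rewrite pair_big /=.
  apply: (haar_invl pi_haar (x := fun p => star (rho i p.1) * x p.2) (y := fun p =>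
    star (rho p.1 k) * y p.2)).
  by rewrite (DeltaM_sum (Delta_star_sum (rho_corep.1 i k)) Da) pair_big.
transitivity (\sum_k rho j k * ((pi (star (rho i k) * a) : C) *: 1)); last first.
  by apply: eq_bigr => k _; rewrite -scalerAr mulr1.
under [RHS]eq_bigr => k _.
  rewrite -inv mulr_sumr.
  under eq_bigr => l _ do rewrite mulr_sumr.
  over.
rewrite exchange_big /= Da slicel_sum; last exact: mull_scalar.
transitivity (\sum_l \sum_m (pi (star (rho i l) * x m) : C) *: ((j == l)%:R * y m)).
  rewrite [RHS](bigD1 j) //= [X in _ + X]big1 ?addr0 => [|l nl].
    by apply: eq_bigr => m _; rewrite eqxx mul1r.
  by rewrite big1 // => m _; rewrite eq_sym (negPf nl) mul0r scaler0.
apply: eq_bigr => l _; rewrite exchange_big /=; apply: eq_bigr => m _.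
rewrite -rinv mulr_suml scaler_sumr; apply: eq_bigr => k _.
by rewrite -scalerAr mulrA.
Qed.

(** Strong invariance with [a] a coefficient of [sigma]: with row indices fixed, the Haar pairings
    form an intertwiner in the column indices. *)
Lemma haar_intertwinesl d d' (rho : 'I_d -> 'I_d -> G) (sigma : 'I_d' -> 'I_d' -> G) :
  mcorep rho -> munitary rho -> mcorep sigma -> forall i k m l,
  \sum_j (pi (star (rho i j) * sigma k l) : C) *: rho m j =
  \sum_p (pi (star (rho i m) * sigma k p) : C) *: sigma p l.
Proof.
move=> h1 h2 h3 i k m l; rewrite -unitary_strong_inv // h3.1 slicel_sum //.
exact: mull_scalar.
Qed.

(** The companion relation in the row indices, with the starred factor on the right: right
    invariance, then multiplication by [rho i p] and unitarity. *)
Lemma haar_intertwinesr d (rho : 'I_d -> 'I_d -> G) :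
  mcorep rho -> munitary rho -> forall k l j p,
  \sum_n (pi (rho n l * star (rho p j)) : C) *: rho k n =
  \sum_i (pi (rho k l * star (rho i j)) : C) *: rho i p.
Proof.
move=> rho_corep rho_unitary k l j p.
have inv i : \sum_n \sum_m (pi (rho n l * star (rho m j)) : C) *: (rho k n * star (rho i m)) =
    (pi (rho k l * star (rho i j)) : C) *: 1.
  rewrite pair_big /=.
  apply: (haar_invr pi_haar (x := fun q => rho k q.1 * star (rho i q.2)) (y := fun q =>
    rho q.1 l * star (rho q.2 j))).
  by rewrite (DeltaM_sum (rho_corep.1 k l) (Delta_star_sum (rho_corep.1 i j))) pair_big.
transitivity (\sum_i ((pi (rho k l * star (rho i j)) : C) *: 1) * rho i p); last first.
  by apply: eq_bigr => i _; rewrite -scalerAl mul1r.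
under [RHS]eq_bigr => i _.
  rewrite -inv mulr_suml.
  under eq_bigr => n _ do rewrite mulr_suml.
  over.
rewrite exchange_big; apply: eq_bigr => n _ /=; rewrite exchange_big /=.
transitivity (\sum_m (pi (rho n l * star (rho m j)) : C) *: (rho k n * (m == p)%:R)).
  rewrite (bigD1 p) //= [X in _ + X]big1 ?addr0 ?eqxx ?mulr1 // => m nm.
  by rewrite (negPf nm) mulr0 scaler0.
apply: eq_bigr => m _; rewrite -rho_unitary mulr_sumr scaler_sumr; apply: eq_bigr => i _.
by rewrite -scalerAl mulrA.
Qed.

Variable I : irrFamily G.
Local Notation rho a := (coef (irr_rep a)).

Let rho_corep (a : I) : mcorep (rho a).
Proof. exact: (coef_mcorep (irr_corep a)). Qed.

Let rho_unitary (a : I) : munitary (rho a).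
Proof. by apply: coef_munitary; exact: irr_unitary. Qed.

Lemma coef_ortho_neq (a b : I) i j k l : a != b ->
  pi (star (rho a i j) * rho b k l) = 0 :> C.
Proof.
move=> nab.
have [Z0|[T [_ _ eqv]]] := schur_mx (irr_irreducible b) (irr_irreducible a)
   (Z := fun n p => pi (star (rho a i n) * rho b k p) : C)
   (fun m l => haar_intertwinesl (rho_corep a) (@rho_unitary a) (rho_corep b) i k m l).
  exact: Z0.
by rewrite (irr_inequiv eqv) eqxx in nab.
Qed.

(** Schur's lemma is used in the column indices and again in the row indices. As [pi] is a trace,
    the constant is the reciprocal of the ordinary dimension. *)
Lemma coef_ortho (a : I) i j k l :
  pi (star (rho a i j) * rho a k l) =
  ((i == k) && (j == l))%:R / (\dim {: irr_sp a})%:R :> C.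
Proof.
have offr i' j' k' l' : j' != l' -> pi (star (rho a i' j') * rho a k' l') = 0 :> C.
  move=> nj; have [c hc] := schur_mx_scalar (irr_irreducible a)
   (fun m l => haar_intertwinesl (rho_corep a) (@rho_unitary a) (rho_corep a) i' k' m l).
  by rewrite hc (negPf nj) mul0r.
have diagr i' j' l' : pi (star (rho a i' j') * rho a i' j') = pi (star (rho a i' l') * rho a i'
  l') :> C.
  have [c hc] := schur_mx_scalar (irr_irreducible a)
   (fun m l => haar_intertwinesl (rho_corep a) (@rho_unitary a) (rho_corep a) i' i' m l).
  by rewrite !hc !eqxx.
(* Traciality moves the starred factor to the right, where [haar_intertwinesr] controls the row
   indices. *)
have offl i' j' k' l' : i' != k' -> pi (star (rho a i' j') * rho a k' l') = 0 :> C.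
  move=> ni; have [c hc] := schur_mx_scalar (irr_irreducible a)
   (fun k p => haar_intertwinesr (rho_corep a) (@rho_unitary a) k l' j' p).
  by rewrite haar_tracial // hc eq_sym (negPf ni) mul0r.
have diagl i' j' k' : pi (star (rho a i' j') * rho a i' j') = pi (star (rho a k' j') * rho a k'
  j') :> C.
  have [c hc] := schur_mx_scalar (irr_irreducible a)
   (fun k p => haar_intertwinesr (rho_corep a) (@rho_unitary a) k j' j' p).
  by rewrite !(haar_tracial pi_haar (star _)) !hc !eqxx.
have [<-|ni] := eqVneq i k; last by rewrite offl // mul0r.
have [<-|nj] := eqVneq j l; last by rewrite offr // mul0r.
have d0 : (\dim {: irr_sp a})%:R != 0 :> C.
  by rewrite pnatr_eq0 dimv_eq0; apply/eqP; case: (irr_irreducible a).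
(* Normalisation: one diagonal entry of rho^* rho = 1 is a sum of as many terms as the dimension,
   all with equal Haar value by [diagl]. *)
apply: (mulIf d0); rewrite divfK //=; transitivity (pi 1 : C); last exact: haar1.
have -> : (1 : G) = \sum_k star (rho a k j) * rho a k j by rewrite rho_unitary eqxx.
rewrite linear_sum (eq_bigr (fun _ => pi (star (rho a i j) * rho a i j))) => [|k' _];
  last exact: diagl.
by rewrite sumr_const card_ord mulr_natr.
Qed.

End Orthogonality.

(** * Completeness of the irreducible coefficients *)

Section MatrixRepresentation.
Variables (R : realType) (G : fqgroup R) (d : nat).
Local Notation C := R[i].
Local Notation star := (@star R G).

Definition rV_hilbert : hilbert R := Hilbert (@spectral.dotmx C d).

Lemma hip_rV (v w : rV_hilbert) :
  hip v w = \sum_i ((v : 'rV[C]_d) 0 i)^* * (w : 'rV[C]_d) 0 i.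
Proof.
rewrite /hip /= spectral.dotmxE mxE; apply: eq_bigr => i _.
by rewrite !mxE mulrC.
Qed.

Variable rho : 'I_d -> 'I_d -> G.

Definition mx_row (i : 'I_d) (v : 'rV[C]_d) : G := \sum_j v 0 j *: rho i j.

(** Realises a coefficient matrix on a standard Hilbert space, the setting in which [irr_complete]
    can be invoked. *)
Definition mx_rep (v : rV_hilbert) : tens rV_hilbert G :=
  \sum_i ptens ('e_i : 'rV[C]_d) (mx_row i v).

Lemma mx_row_linear i : linear (mx_row i).
Proof.
move=> a u v; rewrite /mx_row scaler_sumr -big_split; apply: eq_bigr => j _ /=.
by rewrite !mxE scalerDl scalerA.
Qed.

Lemma mx_rep_linear : linear mx_rep.
Proof.
move=> a u v; rewrite /mx_rep scaler_sumr -big_split; apply: eq_bigr => i _ /=.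
by rewrite mx_row_linear ptensDr ptensZr.
Qed.

HB.instance Definition _ :=
  GRing.isLinear.Build C rV_hilbert (tens rV_hilbert G) _ mx_rep mx_rep_linear.

Lemma mx_row_delta i j : mx_row i 'e_j = rho i j.
Proof.
rewrite /mx_row (bigD1 j) //= mxE !eqxx scale1r [X in _ + X]big1 ?addr0 // => k nk.
by rewrite mxE (negPf nk) scale0r.
Qed.

Lemma mx_rep_corep : mcorep rho -> is_corep mx_rep.
Proof.
move=> [hD hc]; split=> v.
  rewrite /mx_rep !tmap_sum tassoc_sum.
  transitivity (\sum_i \sum_k ptens ('e_k : rV_hilbert) (ptens (rho k i) (mx_row i v))).
    apply: eq_bigr => i _; rewrite /mx_rep /= ptens_suml tassoc_sum; apply: eq_bigr => k _.
    by rewrite tassoc_ptens3 mx_row_delta.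
  rewrite exchange_big; apply: eq_bigr => k _ /=; rewrite -ptens_sumr; congr ptens.
  rewrite {2}/mx_row linear_sum.
  under [RHS]eq_bigr => j _ do rewrite linearZ_LR hD scaler_sumr.
  rewrite exchange_big; apply: eq_bigr => i _ /=.
  by rewrite /mx_row ptens_sumr; apply: eq_bigr => j _; rewrite ptensZr.
rewrite /mx_rep slicer_sum; last exact: counit_scalar.
rewrite [RHS](row_sum_delta v); apply: eq_bigr => i _; congr (_ *: _).
rewrite /mx_row scalarf_sum; last exact: counit_scalar.
rewrite (bigD1 i) //= scalarfZ; last exact: counit_scalar.
rewrite hc eqxx mulr1 big1 ?addr0 // => j nj; rewrite scalarfZ; last exact: counit_scalar.
by rewrite hc eq_sym (negPf nj) mulr0.
Qed.

Lemma mx_rep_unitary : munitary rho -> Defs.is_unitary mx_rep.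
Proof.
move=> hu v w; rewrite /mx_rep tens_ip_sum hip_rV.
transitivity (\sum_i star (mx_row i v) * mx_row i w).
  apply: eq_bigr => i _; rewrite (bigD1 i) //= [X in _ + X]big1 ?addr0 => [|k nk].
    rewrite hip_rV (bigD1 i) //= !mxE !eqxx conjC1 mulr1 big1 ?addr0 ?scale1r // => j nj.
    by rewrite !mxE (negPf nj) mulr0.
  rewrite hip_rV big1 ?scale0r // => j _; rewrite !mxE /=.
  by have [->|] := eqVneq j i; rewrite ?conjC0 ?mul0r // eq_sym (negPf nk) mulr0.
transitivity (\sum_j \sum_l (((v : 'rV[C]_d) 0 j)^* * (w : 'rV[C]_d) 0 l) *: \sum_i star (rho i
  j) * rho i l).
  under [RHS]eq_bigr => j _ do under eq_bigr => l _ do rewrite scaler_sumr.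
  under [RHS]eq_bigr => j _ do rewrite exchange_big /=.
  rewrite exchange_big; apply: eq_bigr => i _ /=.
  rewrite /mx_row star_sum mulr_suml; apply: eq_bigr => j _.
  rewrite mulr_sumr; apply: eq_bigr => l _.
  by rewrite starZ -scalerAl -scalerAr scalerA.
rewrite scaler_suml; apply: eq_bigr => j _; rewrite (bigD1 j) //= hu eqxx.
rewrite [X in _ + X]big1 ?addr0 // => l nl.
by rewrite hu eq_sym (negPf nl) scaler0.
Qed.

End MatrixRepresentation.

(** * Minimal invariant subspaces and the complement of the irreducible coefficients *)

Section Completeness.
Variables (R : realType) (G : fqgroup R).
Local Notation C := R[i].
Local Notation star := (@star R G).

(** Descent on the dimension: a subspace that is not minimal contains a smaller nonzero invariant
    one. *)
Lemma minimal_invariant (V : vectType C) (kappa : {linear V -> tens V G}) (K : {vspace V}) :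
  is_invariant kappa K -> K != 0%VS ->
  exists W : {vspace V}, [/\ (W <= K)%VS, W != 0%VS, is_invariant kappa W &
    forall U : {vspace V}, (U <= W)%VS -> is_invariant kappa U -> U = 0%VS \/ U = W].
Proof.
move: {2}(\dim K) (leqnn (\dim K)) => n; elim: n => [|n IH] in K *.
  by rewrite leqn0 dimv_eq0 => /eqP->; rewrite eqxx.
move=> dK KI K0.
have [min|/existsNP[U /not_implyP[UK /not_implyP[UI /not_orP[U0 UnK]]]]] :=
  pselect (forall U : {vspace V}, (U <= K)%VS -> is_invariant kappa U -> U = 0%VS \/ U = K).
  by exists K; split.
have ltU : (\dim U < \dim K)%N.
  by rewrite ltnNge; apply/negP => le; apply: UnK; apply/eqP; rewrite eqEdim UK.
have dU : (\dim U <= n)%N by rewrite -ltnS (leq_trans ltU).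
have [W [WU W0 WI Wmin]] := IH U dU UI (introN eqP U0).
by exists W; split=> //; exact: subv_trans WU UK.
Qed.

Variable pi : {linear G -> C^o}.
Hypothesis pi_haar : is_haar pi.

Let pi_scalar : scalar (pi : G -> C).
Proof. exact: linear_scalar. Qed.
Local Notation h := (stform (pi : G -> C)).
Let h_scalar := stform_scalar pi_scalar.
Let h_conj := stform_conj pi_scalar (haar_ge0 pi_haar).

Variable I : irrFamily G.
Local Notation rho a := (coef (irr_rep a)).

(** The dimension factor cancels the constant of [coef_ortho], so that pairing with a coefficient
    recovers [c], as in [irr_sumE]. *)
Definition irr_sum (c : forall a : I, 'I_(\dim {: irr_sp a}) -> 'I_(\dim {: irr_sp a}) -> C) :
  G :=
  \sum_(a : I) (\dim {: irr_sp a})%:R *: \sum_i \sum_j c a i j *: rho a i j.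

Lemma irr_sumE c (a : I) k l : pi (star (rho a k l) * irr_sum c) = c a k l :> C.
Proof.
rewrite /irr_sum mulr_sumr scalarf_sum // (bigD1 a) //= [X in _ + X]big1 => [|b nb].
  rewrite addr0 -scalerAr scalarfZ // mulr_sumr scalarf_sum //.
  have d0 : (\dim {: irr_sp a})%:R != 0 :> C.
    by rewrite pnatr_eq0 dimv_eq0; apply/eqP; case: (irr_irreducible a).
  rewrite (bigD1 k) //= [X in _ + X]big1 => [|i ni].
    rewrite addr0 mulr_sumr scalarf_sum // (bigD1 l) //= [X in _ + X]big1 => [|j nj].
      by rewrite addr0 -scalerAr scalarfZ // coef_ortho // !eqxx /= mulrC -mulrA divfK // mulr1.
    by rewrite -scalerAr scalarfZ // coef_ortho // eqxx eq_sym (negPf nj) mul0r mulr0.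
  rewrite mulr_sumr scalarf_sum // big1 // => j _.
  by rewrite -scalerAr scalarfZ // coef_ortho // eq_sym (negPf ni) mul0r mulr0.
rewrite -scalerAr scalarfZ // mulr_sumr scalarf_sum // big1 ?mulr0 // => i _.
rewrite mulr_sumr scalarf_sum // big1 // => j _.
by rewrite -scalerAr scalarfZ // coef_ortho_neq ?mulr0 // eq_sym.
Qed.

(** The [pi]-orthogonal projection onto the span of the irreducible coefficients; [K] below is the
    orthogonal complement. *)
Definition irr_proj (x : G) : G := irr_sum (fun a i j => pi (star (rho a i j) * x)).

Lemma irr_proj_linear : linear irr_proj.
Proof.
move=> c u v; rewrite /irr_proj /irr_sum scaler_sumr -big_split; apply: eq_bigr => a _ /=.
rewrite scalerA mulrC -scalerA -scalerDr; congr (_ *: _).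
rewrite scaler_sumr -big_split; apply: eq_bigr => i _ /=.
rewrite scaler_sumr -big_split; apply: eq_bigr => j _ /=.
by rewrite mulrDr -scalerAr pi_scalar scalerDl scalerA.
Qed.

HB.instance Definition _ := GRing.isLinear.Build C G G _ irr_proj irr_proj_linear.

Let K : {vspace G} := lker (linfun irr_proj).

Let memK x : reflect (forall (a : I) i j, pi (star (rho a i j) * x) = 0 :> C) (x \in K).
Proof.
rewrite memv_ker lfunE /=; apply: (iffP eqP) => [P0 a i j|h0].
  rewrite -(irr_sumE (fun a i j => pi (star (rho a i j) * x))) -/(irr_proj x).
  by rewrite P0 mulr0 scalarf0.
rewrite /irr_proj /irr_sum big1 // => a _; rewrite big1 ?scaler0 // => i _.
by rewrite big1 // => j _; rewrite h0 scale0r.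
Qed.

(** By [unitary_strong_inv], pairing a slice of [Delta x] with a coefficient only involves pairings
    of [x] itself with coefficients. *)
Let K_invariant : is_invariant (@Delta R G) K.
Proof.
apply/is_invariantP => x /memK x0 phi hphi; apply/memK => a i j.
have sc : scalar (fun y => pi (star (rho a i j) * y) : C) by exact: mull_scalar.
rewrite -(slice_swap _ sc hphi).
have rc : mcorep (rho a) by exact: (coef_mcorep (irr_corep a)).
have ru : munitary (rho a) by apply: coef_munitary; exact: irr_unitary.
rewrite unitary_strong_inv // big1 ?scalarf0 // => k _.
by rewrite x0 scale0r.
Qed.

Let K0 : K = 0%VS.
Proof.
apply/eqP; apply/contraT => Kn0.
have [W [WK W0 WI Wmin]] := minimal_invariant K_invariant Kn0.
have [w [wW w_ortho w_span]] := orthonormal_basis h_scalar h_conj (haar_posdef pi_haar) W.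
pose r i j := slicel (h (w i)) (Delta (w j)).
have Dw j : Delta (w j) = \sum_i ptens (w i) (r i j).
  have /is_invariantP/(_ _ (wW j)) hW := WI.
  (* Invariance puts the slices of [Delta (w j)] in [W], where they expand along [w]. *)
  have [g E] : exists g, Delta (w j) = \sum_i ptens (w i) (g i).
    exists (fun i => \sum_(m < \dim {:G})
     h (w i) (slicer (coord (fbasis G) m) (Delta (w j))) *: (fbasis G)`_m).
    rewrite [LHS]tens_expand_slicer.
    under [RHS]eq_bigr => i _ do rewrite ptens_sumr.
    rewrite exchange_big; apply: eq_bigr => m _ /=.
    rewrite -{1}(w_span _ (hW _ (@coord_scalar _ _ m))) ptens_suml.
    by apply: eq_bigr => i _; rewrite ptensZl ptensZr.
  rewrite E; apply: eq_bigr => i _; congr ptens; rewrite /r E slicel_sum //.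
  rewrite (bigD1 i) //= w_ortho eqxx scale1r [X in _ + X]big1 ?addr0 // => k nk.
  by rewrite w_ortho eq_sym (negPf nk) scale0r.
have rc : mcorep r := corep_mcorep (@Delta_is_corep R G) (fun i => h_scalar (w i)) w_ortho Dw.
have ru : munitary r := haar_munitary pi_haar w_ortho Dw.
(* [T] below transports the corepresentation on row vectors onto [W], so minimality of [W] becomes
   irreducibility of [kappa]. *)
pose V := rV_hilbert R (\dim W).
pose kappa : {linear V -> tens V G} := mx_rep r.
pose T0 (v : V) : G := \sum_j (v : 'rV[C]_(\dim W)) 0 j *: w j.
have T0_lin : linear T0.
  move=> c u v; rewrite /T0 scaler_sumr -big_split; apply: eq_bigr => j _ /=.
  by rewrite !mxE scalerDl scalerA.
pose TL := HB.pack_for {linear V -> G} T0 (GRing.isLinear.Build _ _ _ _ _ T0_lin).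
pose T : 'Hom(V, G) := linfun TL.
have TE v : T v = \sum_j (v : 'rV[C]_(\dim W)) 0 j *: w j by rewrite lfunE.
have TW v : T v \in W by rewrite TE memv_suml // => j _; rewrite memvZ.
have T_onto x : x \in W -> exists v, T v = x.
  move=> xW; exists (\row_j h (w j) x); rewrite TE -[RHS]w_span //.
  by apply: eq_bigr => j _; rewrite mxE.
have T_inj : injective T.
  move=> u v e; apply/rowP => i; have := congr1 (h (w i)) e; rewrite !TE !scalarf_sum //.
  have pick (z : V) : \sum_j h (w i) ((z : 'rV[C]_(\dim W)) 0 j *: w j) = (z : 'rV[C]_(\dim W))
    0 i.
    rewrite (bigD1 i) //= scalarfZ // w_ortho eqxx mulr1 big1 ?addr0 // => j nj.
    by rewrite scalarfZ // w_ortho eq_sym (negPf nj) mulr0.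
  by rewrite !pick.
have DT v : Delta (T v) = \sum_i ptens (w i) (mx_row r i v).
  rewrite TE linear_sum; under eq_bigr => j _ do rewrite linearZ_LR Dw scaler_sumr.
  rewrite exchange_big; apply: eq_bigr => i _ /=; rewrite /mx_row ptens_sumr.
  by apply: eq_bigr => j _; rewrite ptensZr.
have T_inter v (phi : G -> C) : scalar phi -> slicer phi (Delta (T v)) = T (slicer phi (kappa v)).
  move=> hphi; rewrite DT slicer_sum // /kappa /= /mx_rep slicer_sum // linear_sum.
  apply: eq_bigr => i _; rewrite linearZ_LR /= TE; congr (_ *: _).
  rewrite (bigD1 i) //= mxE !eqxx scale1r [X in _ + X]big1 ?addr0 // => j nj.
  by rewrite mxE (negPf nj) scale0r.
have kirr : irreducible kappa.
  split=> [V0|U UI].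
    case/eqP: W0; apply/eqP; rewrite -dimv_eq0 -leqn0.
    have dV : \dim {:V} = \dim W by rewrite dimvf; exact: mul1n.
    by rewrite -dV V0 dimv0.
  have TUI : is_invariant (@Delta R G) (T @: U).
    apply/is_invariantP => _ /memv_imgP[u uU ->] phi hphi.
    by rewrite T_inter // memv_img //; move/is_invariantP: UI; apply.
  have TUW : (T @: U <= W)%VS by apply/subvP => _ /memv_imgP[u uU ->].
  have [TU0|TUf] := Wmin _ TUW TUI; [left|right].
    apply/eqP; rewrite -subv0; apply/subvP => u uU.
    have := memv_img T uU; rewrite TU0 !memv0 -{1}(linear0 T) => /eqP /T_inj ->.
    by rewrite eqxx.
  apply/vspaceP => v; rewrite memvf; have := TW v; rewrite -TUf.
  by case/memv_imgP => u uU /T_inj ->.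
have [a [S [bS hS]]] := irr_complete I (mx_rep_corep rc) (mx_rep_unitary ru) kirr.
have Skernel : lker S == 0%VS by apply/lker0P; exact: bij_inj.
pose psi i (u : irr_sp a) : C := ((S^-1)%VF u : 'rV[C]_(\dim W)) 0 i.
have psi_scalar i : scalar (psi i) by move=> c u v; rewrite /psi linearP !mxE.
(* Through the equivalence [S], the coefficients of [kappa] become combinations of those of the
   irreducible [a]. *)
have rowE i v : mx_row r i v = \sum_l \sum_k (hip (onb (irr_sp a) l) (S v) * psi i (onb (irr_sp
  a) k)) *: rho a k l.
  have := congr1 (slicel (psi i)) (hS v); rewrite [kappa v]/(mx_rep r v) tmap_sum slicel_sum //.
  rewrite (bigD1 i) //= /psi lker0_lfunK // mxE !eqxx scale1r [X in _ + X]big1 ?addr0 =>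
    [<-|k nk].
    exact: (slicel_coef (irr_rep a) (S v) (psi_scalar i)).
  by rewrite lker0_lfunK // mxE eq_sym (negPf nk) scale0r.
(* By the counit, [x] is a combination of coefficients of [a]; lying in [K], it is orthogonal to
   them, hence to itself. *)
have w0 x : x \in W -> x = 0.
  move=> xW; apply: (haar_faithful pi_haar).
  have xK : forall (b : I) i j, pi (star (rho b i j) * x) = 0 :> C by apply/memK;
    exact: (subvP WK).
  have [v Tv] := T_onto _ xW.
  have xE : x = \sum_i (counit (w i) : C) *: mx_row r i v.
    by rewrite -[LHS]counit_l -Tv DT slicel_sum //; exact: counit_scalar.
  rewrite {1}xE star_sum mulr_suml scalarf_sum // big1 // => i _.
  rewrite starZ -scalerAl scalarfZ // rowE star_sum mulr_suml scalarf_sum // big1 ?mulr0 // =>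
    l _.
  rewrite star_sum mulr_suml scalarf_sum // big1 // => k _.
  by rewrite starZ -scalerAl scalarfZ // xK mulr0.
case/eqP: W0; apply/eqP; rewrite -subv0; apply/subvP => x /w0 ->; exact: mem0v.
Qed.

Lemma irr_proj_id x : irr_proj x = x.
Proof.
apply/eqP; rewrite eq_sym -subr_eq0 -memv0 -K0; apply/memK => a i j.
by rewrite mulrBr scalarfB // irr_sumE subrr.
Qed.

End Completeness.

(** * Fourier transforms and the upper bound *)

Section ConjugateSpace.
Variables (R : realType) (G : fqgroup R) (V : hilbert R).
Local Notation C := R[i].
Local Notation star := (@star R G).

Definition conjb (i : 'I_(\dim {:V})) : conjsp V := conjv (onb V i).

Lemma conj_hip_scalar (v : conjsp V) : scalar (conj_hip v).
Proof.
move=> a u w; rewrite /conj_hip -[a *: u]/(a^* *: (u : V)) -/(_ + _).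
rewrite hermDl; [|exact: hip_scalar|exact: hip_conj].
by rewrite hermZl ?conjCK //; [exact: hip_scalar|exact: hip_conj].
Qed.

Lemma conj_hip_conj (v w : conjsp V) : conj_hip w v = (conj_hip v w)^*.
Proof. exact: hip_conj. Qed.

Lemma conjb_ortho i j : conj_hip (conjb i) (conjb j) = (i == j)%:R.
Proof. by rewrite /conj_hip onb_ortho eq_sym. Qed.

Lemma conj_sum (J : finType) (c : J -> C) (v : J -> conjsp V) :
  \sum_j c j *: v j = \sum_j (c j)^* *: (v j : V) :> V.
Proof. by []. Qed.

Lemma conjb_span (v : conjsp V) : \sum_i conj_hip (conjb i) v *: conjb i = v.
Proof.
rewrite conj_sum -[RHS](onb_span (v : V)); apply: eq_bigr => i _.
by rewrite /conj_hip -hip_conj.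
Qed.

Lemma conj_hip_norm (c : 'I_(\dim {:V}) -> C) :
  conj_hip (\sum_i c i *: conjb i) (\sum_i c i *: conjb i) = \sum_i `|c i| ^+ 2.
Proof.
have hs := conj_hip_scalar; have hc := conj_hip_conj.
rewrite scalarf_sum //; apply: eq_bigr => i _; rewrite scalarfZ // herm_suml //.
rewrite (bigD1 i) //= hermZl // conjb_ortho eqxx mulr1 big1 ?addr0 -?normCK // => j nj.
by rewrite hermZl // conjb_ortho (negPf nj) mulr0.
Qed.

Lemma lfun_pow_comm (T : 'End(conjsp V)) k v : lfun_pow T k (T v) = T (lfun_pow T k v).
Proof.
elim: k => [|k IH]; first by rewrite !id_lfunE.
by rewrite /lfun_pow /= !comp_lfunE -/(lfun_pow T k) IH.
Qed.

Lemma is_adjoint_pow (T S : 'End(conjsp V)) k :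
  is_adjoint T S -> is_adjoint (lfun_pow T k) (lfun_pow S k).
Proof.
move=> h; elim: k => [|k IH] v w; first by rewrite !id_lfunE.
rewrite /lfun_pow /= !comp_lfunE -/(lfun_pow T k) -/(lfun_pow S k).
by rewrite h IH lfun_pow_comm.
Qed.

(** Existence is what the choice in [adjoint] requires; the witness has the numbers <T e_i, v> as
    coordinates of its value at [v]. *)
Lemma adjointP (T : 'End(conjsp V)) : is_adjoint T (adjoint T).
Proof.
apply: (@xgetPex _ 0 [set S | is_adjoint T S]%classic).
have hs := conj_hip_scalar; have hc := conj_hip_conj.
pose f v := \sum_i conj_hip (T (conjb i)) v *: conjb i.
have f_lin : linear f.
  move=> a u v; rewrite /f scaler_sumr -big_split; apply: eq_bigr => p _ /=.
  by rewrite hs scalerDl scalerA.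
pose L := HB.pack_for {linear conjsp V -> conjsp V} f (GRing.isLinear.Build _ _ _ _ _ f_lin).
exists (linfun L) => v w; rewrite lfunE /= /f herm_suml //.
rewrite -[in RHS](conjb_span w) linear_sum scalarf_sum //; apply: eq_bigr => i _.
by rewrite hermZl // linearZ /= scalarfZ // -hc mulrC.
Qed.

Lemma trace_adjoint_pow (T : 'End(conjsp V)) k :
  lfun_trace (lfun_pow (adjoint T) k \o lfun_pow T k)%VF =
  \sum_i conj_hip (lfun_pow T k (conjb i)) (lfun_pow T k (conjb i)).
Proof.
rewrite (lfun_traceE _ (fun i => conj_hip_scalar (conjb i)) conjb_span).
apply: eq_bigr => i _; rewrite comp_lfunE conj_hip_conj.
by rewrite (is_adjoint_pow k (adjointP T)) -conj_hip_conj.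
Qed.

Variable kappa : {linear V -> tens V G}.

(** [conjrep] is defined through [fbasis]; two antilinear changes of basis give the same formula in
    the orthonormal one. *)
Lemma conjrep_conjb j :
  conjrep kappa (conjb j) = \sum_k ptens (conjb k) (star (coef kappa k j)).
Proof.
rewrite /conjrep.
transitivity (\sum_(i < \dim {:V}) ptens (conjv (fbasis V)`_i)
   (star (slicel (coord (fbasis V) i) (kappa (onb V j))))).
  under eq_bigr => l _ do rewrite scaler_sumr.
  rewrite exchange_big; apply: eq_bigr => i _ /=.
  pose S : {linear V -> G} := @slicel _ V G (coord (fbasis V) i) \o kappa.
  rewrite -[slicel _ _]/(S (onb V j)) -[in RHS](fbasisE (onb V j)) linear_sum star_sum ptens_sumr.
  by apply: eq_bigr => l _; rewrite linearZ_LR starZ ptensZr.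
under eq_bigr => i _.
  rewrite coefE slicel_sum; last exact: coord_scalar.
  rewrite star_sum ptens_sumr.
  under eq_bigr => k _ do rewrite starZ ptensZr -ptensZl.
  over.
rewrite exchange_big; apply: eq_bigr => k _ /=; rewrite -ptens_suml; congr ptens.
rewrite conj_sum /conjb -[RHS](fbasisE (onb V k)).
by apply: eq_bigr => i _; rewrite conjCK.
Qed.

Lemma fourier_conjb (phi : {linear G -> C^o}) j :
  fourier kappa phi (conjb j) = \sum_k (phi (star (coef kappa k j)) : C) *: conjb k.
Proof. by rewrite lfunE /= conjrep_conjb slicer_sum //; exact: linear_scalar. Qed.

Lemma convpowS (nu : {linear G -> C^o}) k :
  convpow nu k.+2 = conv nu (convpow nu k.+1).
Proof. by []. Qed.

(** The Fourier transform turns convolution into composition. Exponents start at 1, where [convpow]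
    is meaningful. *)
Lemma fourier_pow (nu : {linear G -> C^o}) : mcorep (coef kappa) -> forall k j,
  lfun_pow (fourier kappa nu) k.+1 (conjb j) =
  \sum_l (convpow nu k.+1 (star (coef kappa l j)) : C) *: conjb l.
Proof.
move=> hc; elim=> [|k IH] j.
  by rewrite /lfun_pow /= comp_lfunE id_lfunE fourier_conjb.
rewrite -[lfun_pow _ k.+2]/(fourier kappa nu \o lfun_pow (fourier kappa nu) k.+1)%VF.
rewrite comp_lfunE IH.
rewrite linear_sum.
under eq_bigr => l _ do rewrite linearZ_LR /= fourier_conjb scaler_sumr.
rewrite exchange_big; apply: eq_bigr => m _ /=.
under eq_bigr => l _ do rewrite scalerA.
rewrite -scaler_suml; congr (_ *: _).
(* [star] acts on each leg without swapping them, so the matrix product keeps the order of the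
   convolution. *)
transitivity (tfun nu (convpow nu k.+1) (Delta (star (coef kappa m j))) : C); last by [].
rewrite (Delta_star_sum (hc.1 m j)) tfun_sum; try exact: linear_scalar.
by apply: eq_bigr => l _; rewrite mulrC.
Qed.

Lemma trace_fourier (nu : {linear G -> C^o}) k : mcorep (coef kappa) ->
  lfun_trace (lfun_pow (adjoint (fourier kappa nu)) k.+1 \o
              lfun_pow (fourier kappa nu) k.+1)%VF =
  \sum_i \sum_j `|(convpow nu k.+1 (star (coef kappa i j)) : C)| ^+ 2.
Proof.
move=> hc; rewrite trace_adjoint_pow exchange_big; apply: eq_bigr => j _ /=.
by rewrite fourier_pow // conj_hip_norm.
Qed.

End ConjugateSpace.

Lemma convpow1 (R : realType) (G : fqgroup R) (nu : {linear G -> R[i]^o}) k :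
  nu 1 = 1 -> convpow nu k.+1 1 = 1.
Proof.
move=> nu1; elim: k => [|k IH] //.
rewrite convpowS /conv /= Delta1 tfun_ptens; try exact: linear_scalar.
by rewrite nu1 IH mul1r.
Qed.

Section Trivial.
Variables (R : realType) (G : fqgroup R) (V : hilbert R).
Variable kappa : {linear V -> tens V G}.

(** The equivalence carries [z] (x) 1 back to [kappa v] = [v] (x) 1. *)
Lemma coef_trivial : equivalent kappa (@trivrep R G) ->
  forall i j, coef kappa i j = (i == j)%:R.
Proof.
move=> [T [bT hT]] i j.
have kE v : kappa v = ptens v 1.
  apply: slicer_inj => phi hphi; apply: (bij_inj bT).
  rewrite -(slicer_tmap T (kappa v) hphi) -hT /trivrep.
  by rewrite !slicer_ptens // linearZ.
rewrite /coef kE slicel_ptens; last exact: hip_scalar.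
by rewrite onb_ortho scaler_nat.
Qed.

End Trivial.

(** * The deviation from the Haar state at a projection *)

Section UpperBound.
Variables (R : realType) (G : fqgroup R) (I : irrFamily G) (tau : I).
Local Notation C := R[i].
Local Notation star := (@star R G).
Hypothesis tau_trivial : equivalent (irr_rep tau) (@trivrep R G).
Variables (pi : {linear G -> C^o}) (phi : {linear G -> C^o}).
Hypotheses (pi_haar : is_haar pi) (phi1 : phi 1 = 1 :> C).
Local Notation rho a := (coef (irr_rep a)).

Let pi_scalar : scalar (pi : G -> C).
Proof. exact: linear_scalar. Qed.

Let mu (x : G) : C := phi x - pi x.

Let mu_scalar : scalar mu.
Proof. by move=> a u v; rewrite /mu !linearP /= /GRing.scale /=; ring. Qed.

Let mu1 : mu 1 = 0.
Proof. by rewrite /mu phi1 haar1 // subrr. Qed.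

Let mu_tau i j : mu (star (rho tau i j)) = 0.
Proof.
rewrite (coef_trivial tau_trivial); case: (i == j); last by rewrite star0 scalarf0.
by rewrite star1 mu1.
Qed.

(** The trivial representation has the coefficient 1, so orthogonality to it makes [pi] vanish on
    the starred coefficients of [a]. *)
Let mu_neq a i j : a != tau -> mu (star (rho a i j)) = phi (star (rho a i j)).
Proof.
move=> na; have d0 : (0 < \dim {: irr_sp tau})%N.
  by rewrite lt0n dimv_eq0; apply/eqP; case: (irr_irreducible tau).
pose k := Ordinal d0; have := coef_ortho_neq pi_haar i j k k na.
by rewrite (coef_trivial tau_trivial) eqxx mulr1 /mu => ->; rewrite subr0.
Qed.

Let f := irr_sum (fun (a : I) i j => mu (star (rho a i j))).

(* [f] is the Radon-Nikodym derivative of [mu] with respect to [pi]. *)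
Let mu_density x : pi (star x * f) = mu (star x) :> C.
Proof.
rewrite -(irr_proj_id pi_haar I x) /irr_proj /irr_sum !star_sum mulr_suml !scalarf_sum //.
apply: eq_bigr => a _; rewrite starZ -scalerAl !scalarfZ //; congr (_ * _).
rewrite !star_sum mulr_suml !scalarf_sum //; apply: eq_bigr => i _.
rewrite !star_sum mulr_suml !scalarf_sum //; apply: eq_bigr => j _.
by rewrite starZ -scalerAl !scalarfZ // irr_sumE.
Qed.

(** [mu_density] at [f] gives [mu (star f)]; expanding [f] pairs each coefficient value with its own
    conjugate. *)
Let mu_f : pi (star f * f) = \sum_(a : I | a != tau) (\dim {: irr_sp a})%:R *
    \sum_i \sum_j `|(phi (star (rho a i j)) : C)| ^+ 2 :> C.
Proof.
rewrite mu_density /f /irr_sum star_sum scalarf_sum // (bigD1 tau) //= [X in X + _](_ : _ = 0).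
  rewrite add0r; apply: eq_bigr => a na; rewrite starZ scalarfZ // conjC_nat; congr (_ * _).
  rewrite star_sum scalarf_sum //; apply: eq_bigr => i _.
  rewrite star_sum scalarf_sum //; apply: eq_bigr => j _.
  by rewrite starZ scalarfZ // mu_neq // normCK mulrC.
rewrite starZ scalarfZ // star_sum scalarf_sum // big1 ?mulr0 // => i _.
rewrite star_sum scalarf_sum // big1 // => j _.
by rewrite starZ scalarfZ // mu_tau mulr0.
Qed.

(* Since [mu 1 = 0], [2 mu p = mu u] for the self-adjoint unitary [u = 2p - 1]. *)
Lemma upper_bound p : is_projection p ->
  `|(phi p : C) - pi p| ^+ 2 <= 4%:R^-1 *
    \sum_(a : I | a != tau) (\dim {: irr_sp a})%:R *
      \sum_i \sum_j `|(phi (star (rho a i j)) : C)| ^+ 2.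
Proof.
move=> [ps pp]; rewrite -/(mu p) -mu_f.
pose u := p + p - 1.
have us : star u = u by rewrite /u starB starD ps star1.
have uu : u * u = 1.
  have up : u * p = p by rewrite /u mulrBl mulrDl pp mul1r addrK.
  by rewrite {2}/u mulrBr mulrDr up mulr1 /u subKr.
have mu_u : mu u = 2%:R * mu p by rewrite /u scalarfB // scalarfD // mu1; ring.
have h1 := stform_scalar pi_scalar; have h2 := stform_conj pi_scalar (haar_ge0 pi_haar).
(* Since [u * u = 1], the factor of [u] is 1; the constant 1/4 comes from the square of
   [mu u = 2 mu p]. *)
have := herm_CauchySchwarz h1 h2 (haar_ge0 pi_haar) u f.
rewrite /stform mu_density us uu haar1 // mul1r mu_u normrM exprMn normr_nat -natrX.
by rewrite ler_pdivlMl ?ltr0n.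
Qed.

End UpperBound.

(** * From projections to the total variation distance *)

Lemma tvdist_le (R : realType) (A : cstarAlg R) (nu mu : {linear A -> R[i]^o}) (B : R[i]) :
  0 <= B ->
  (forall p, is_projection p -> `|(nu p : R[i]) - mu p| ^+ 2 <= B) ->
  ((tvdist nu mu ^+ 2)%:C)%C <= B.
Proof.
move=> B0 hB.
(* A nonnegative complex number is real, so the comparison can take place in [R]. *)
have BE : B = (complex.Re B)%:C%C by rewrite RRe_real // realE B0.
have rB0 : 0 <= complex.Re B by rewrite -lecR -BE.
have normc_ge0 (z : R[i]) : 0 <= Normc.normc z by case: z => x y; exact: sqrtr_ge0.
have ub p : is_projection p -> Normc.normc (nu p - mu p : R[i]) <= Num.sqrt (complex.Re B).
  move=> /hB; have -> : `|(nu p : R[i]) - mu p| = (Normc.normc (nu p - mu p : R[i]))%:C%C by [].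
  rewrite -rmorphXn BE lecR => le.
  by rewrite -(@ler_pXn2r _ 2) ?nnegrE ?sqrtr_ge0 ?sqr_sqrtr // normc_ge0.
have p0 : is_projection (0 : A) by split; rewrite ?mulr0 ?star0.
have ne : ([set Normc.normc (nu p - mu p : R[i]) | p in [set p : A | is_projection p]]
  !=set0)%classic.
  by exists (Normc.normc (nu 0 - mu 0 : R[i])); exists 0.
rewrite BE lecR /tvdist.
have le : tvdist nu mu <= Num.sqrt (complex.Re B) by apply: ge_sup => // _ [p pp <-]; exact: ub.
rewrite -[leRHS]sqr_sqrtr // ler_pXn2r ?nnegrE ?sqrtr_ge0 //.
(* The projection 0 contributes the value 0, so the supremum is nonnegative and the inequality may
   be squared. *)
have <- : Normc.normc (nu 0 - mu 0 : R[i]) = 0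
  by rewrite (scalarf0 (linear_scalar nu)) (scalarf0 (linear_scalar mu)) subrr Normc.normc0.
by apply: ub_le_sup; [exists (Num.sqrt (complex.Re B)) => _ [p pp <-]; exact: ub|exists 0].
Qed.

Theorem lemma3p10 (R : realType) (G : fqgroup R) (I : irrFamily G) (tau : I)
  (htau : equivalent (irr_rep tau) (@trivrep R G))
  (pi : {linear G -> R[i]^o}) (hpi : is_haar pi)
  (nu : {linear G -> R[i]^o}) (hnu : is_state nu)
  (k : nat) (hk : (1 <= k)%N) :
  ((tvdist (convpow nu k) pi ^+ 2)%:C)%C <=
    4%:R^-1 * \sum_(a : I | a != tau)
      (\dim {: irr_sp a})%:R *
      lfun_trace (lfun_pow (adjoint (fourier (irr_rep a) nu)) k \o
                  lfun_pow (fourier (irr_rep a) nu) k)%VF.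
Proof.
(* In orthonormal bases each trace is a squared Hilbert-Schmidt norm, the form in which
   [upper_bound] is stated. *)
case: k hk => // k _; under eq_bigr => a _.
  rewrite trace_fourier; last exact: coef_mcorep (irr_corep a).
  over.
apply: tvdist_le => [|p pp].
  rewrite mulr_ge0 ?invr_ge0 ?ler0n // sumr_ge0 // => a _; rewrite mulr_ge0 ?ler0n //.
  by rewrite sumr_ge0 // => i _; rewrite sumr_ge0 // => j _; rewrite exprn_ge0.
exact: (upper_bound htau hpi (convpow1 k hnu.1) pp).
Qed.
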